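(* Let $a\in\mathcal B(\mathcal H)$ be a normal operator. The following conditions are equivalent: (i) The groupoid orbit $\mathcal O_a$ of $a$ is closed in $\mathcal B(\mathcal H)$ in the operator norm topology. (ii) The compact set $\operatorname{spec}(a)$ accumulates at most at the point $0\in\mathbb C$ (i.e., it has no nonzero accumulation point).
   Context: $\mathcal H$ is a separable infinite-dimensional complex Hilbert space. For normal $a\in\mathcal B(\mathcal H)$, $p_a$ denotes the orthogonal projection onto $\overline{\operatorname{Ran}a}$, and the groupoid orbit of $a$ is $\mathcal O_a:=\{vav^*\mid v\in\mathcal B(\mathcal H),\ v^*v=p_a\}$. *)

(* Defs.v *)
From HB Require Import structures.
From mathcomp Require Import all_boot all_order all_algebra.
From mathcomp Require Import all_classical all_reals all_analysis.
From mathcomp Require Import complex.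

Set Implicit Arguments.
Unset Strict Implicit.
Unset Printing Implicit Defensive.
Import Order.TTheory GRing.Theory Num.Theory.
Import numFieldNormedType.Exports.
Local Open Scope classical_set_scope.
Local Open Scope ring_scope.

(* The modulus topology on R[i], otherwise only attached to the regular module
   R[i]^o. *)
HB.instance Definition _ (R : realType) := NormedModule.copy R[i] R[i]^o.

(* The inner product is linear in its first argument. *)
HB.mixin Record CompleteNormedModule_isHilbert (R : realType) H
    & CompleteNormedModule R[i] H := {
  inner : {dot H for Num.conj};
  normr_inner : forall x : H, `|x| ^+ 2 = inner x x
}.

#[short(type="hilbertType")]
HB.structure Definition Hilbert (R : realType) :=
  {H of CompleteNormedModule R[i] H & CompleteNormedModule_isHilbert R H}.

Definition separable (T : topologicalType) : Prop :=
  exists2 D : set T, countable D & dense D.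

Definition finite_dimensional (K : nzRingType) (V : lmodType K) : Prop :=
  exists (n : nat) (e : 'I_n -> V),
    forall x, exists c : 'I_n -> K, x = \sum_(i < n) c i *: e i.

Section BoundedOperators.
Context (R : realType) (H : hilbertType R).
Lemma realCD (s t : R) : (s + t)%:C%C = s%:C%C + t%:C%C :> R[i].
Proof. exact: rmorphD. Qed.

Lemma realCM (s t : R) : (s * t)%:C%C = s%:C%C * t%:C%C :> R[i].
Proof. exact: rmorphM. Qed.

Implicit Types (x y : H).

Definition bounded_linear : {pred H -> H} :=
  mem [set f : H -> H | linear f /\
    exists M : R, forall x, `|f x| <= M%:C%C * `|x|].

Record bop := BOp { bop_fun :> H -> H ; bop_mem : bop_fun \in bounded_linear }.

HB.instance Definition _ := [isSub for bop_fun].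
HB.instance Definition _ := gen_eqMixin bop.
HB.instance Definition _ := gen_choiceMixin bop.

Lemma bounded_linearP (f : H -> H) : reflect
  (linear f /\ exists M : R, forall x, `|f x| <= M%:C%C * `|x|)
  (f \in bounded_linear).
Proof. by apply: (iffP idP) => [/set_mem|/mem_set]. Qed.

Lemma normC_complex x : `|x| = (complex.Re `|x|)%:C%C.
Proof. by rewrite RRe_real// normr_real. Qed.

Lemma bounded_linear_submod_closed : submod_closed bounded_linear.
Proof.
split=> [|a f g /bounded_linearP[lf [M fM]] /bounded_linearP[lg [N gN]]].
  apply/bounded_linearP; split; first by move=> a x y; rewrite /= scaler0 addr0.
  by exists 0 => x; rewrite mul0r normr0.
apply/bounded_linearP; split.
  move=> b x y; rewrite /= !fctE /= lf lg !scalerDr !scalerA mulrC.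
  by rewrite addrACA.
exists (complex.Re `|a| * M + N) => x.
rewrite !fctE (le_trans (ler_normD _ _))// normrZ realCD realCM mulrDl.
rewrite lerD// -mulrA RRe_real ?normr_real//.
by rewrite ler_wpM2l.
Qed.

HB.instance Definition _ :=
  GRing.isSubmodClosed.Build _ _ bounded_linear bounded_linear_submod_closed.
HB.instance Definition _ := [SubChoice_isSubLmodule of bop by <:].

Implicit Types (f g h : bop).

Lemma bopP f g : (forall x, f x = g x) -> f = g.
Proof. by move=> fg; apply/val_inj/funext. Qed.

Lemma bop_linear f : linear f.
Proof. by have /bounded_linearP[] := bop_mem f. Qed.

HB.instance Definition _ f := GRing.isLinear.Build _ _ _ _ f (bop_linear f).

Lemma bop_bounded f : exists M : R, forall x, `|f x| <= M%:C%C * `|x|.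
Proof. by have /bounded_linearP[] := bop_mem f. Qed.

Lemma bop_id_subproof : (id : H -> H) \in bounded_linear.
Proof. by apply/bounded_linearP; split=> //; exists 1 => x; rewrite mul1r. Qed.

Lemma bop_comp_subproof f g : f \o g \in bounded_linear.
Proof.
apply/bounded_linearP; split=> [a x y|]; first by rewrite /= !linearP.
have [M fM] := bop_bounded f; have [N gN] := bop_bounded g.
exists (`|M| * N) => x; rewrite realCM -mulrA.
apply: (le_trans (fM _)); apply: (@le_trans _ _ (`|M|%:C%C * `|g x|)).
  by rewrite ler_wpM2r// lecR ler_norm.
by rewrite ler_wpM2l// lecR normr_ge0.
Qed.

Definition bop_id := BOp bop_id_subproof.
Definition bop_comp f g := BOp (bop_comp_subproof f g).

Fact bop_compA : associative bop_comp. Proof. by move=> f g h; exact: bopP. Qed.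
Fact bop_comp1f : left_id bop_id bop_comp. Proof. by move=> f; exact: bopP. Qed.
Fact bop_compf1 : right_id bop_id bop_comp. Proof. by move=> f; exact: bopP. Qed.
Fact bop_compDl : left_distributive bop_comp +%R.
Proof. by move=> f g h; exact: bopP. Qed.
Fact bop_compDr : right_distributive bop_comp +%R.
Proof. by move=> f g h; apply: bopP => x; rewrite /= linearD. Qed.

HB.instance Definition _ := GRing.Zmodule_isPzRing.Build bop
  bop_compA bop_comp1f bop_compf1 bop_compDl bop_compDr.

Definition opnorm f : R := sup [set complex.Re `|f x| | x in [set x : H | `|x| <= 1]].

Lemma opnorm_has_sup f :
  has_sup [set complex.Re `|f x| | x in [set x : H | `|x| <= 1]].
Proof.
split; first by exists (complex.Re `|f 0|), 0 => //=; rewrite normr0 ler01.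
have [M fM] := bop_bounded f; exists `|M| => _ [x /= x1 <-].
rewrite -lecR -normC_complex (le_trans (fM x))//.
apply: (@le_trans _ _ (`|M|%:C%C * `|x|)); first by rewrite ler_wpM2r// lecR ler_norm.
by rewrite ler_piMr// lecR normr_ge0.
Qed.

Lemma opnorm_ge0 f : 0 <= opnorm f.
Proof.
apply: le_trans (sup_upper_bound (opnorm_has_sup f) _); last first.
  by exists 0; rewrite //= ?normr0 ?ler01.
by rewrite linear0 normr0.
Qed.

Lemma le_opnorm f x : `|f x| <= (opnorm f)%:C%C * `|x|.
Proof.
have [->|x0] := eqVneq x 0; first by rewrite linear0 !normr0 mulr0.
have nx0 : 0 < `|x| by rewrite normr_gt0.
have E : `|f x| / `|x| = `|f (`|x|^-1 *: x)|.
  by rewrite linearZ normrZ normfV normr_id mulrC.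
rewrite -ler_pdivrMr// E (normC_complex (f _)) lecR.
apply: (sup_upper_bound (opnorm_has_sup f)).
by exists (`|x|^-1 *: x) => //=; rewrite normrZ normfV normr_id mulVf ?gt_eqF.
Qed.

Lemma opnorm_le f (M : R) :
  (forall x, `|x| <= 1 -> `|f x| <= M%:C%C) -> opnorm f <= M.
Proof.
move=> fM; apply: ge_sup; first by case: (opnorm_has_sup f).
by move=> _ [x /= x1 <-]; rewrite -lecR -normC_complex fM.
Qed.

Fact opnormD f g : (opnorm (f + g))%:C%C <= (opnorm f)%:C%C + (opnorm g)%:C%C :> R[i].
Proof.
rewrite -realCD lecR; apply: opnorm_le => x x1.
rewrite realCD (le_trans (ler_normD _ _))// lerD// (le_trans (le_opnorm _ _))//.
- by rewrite ler_piMr// lecR opnorm_ge0.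
- by rewrite ler_piMr// lecR opnorm_ge0.
Qed.

Lemma opnormZ_le (a : R[i]) f : (opnorm (a *: f))%:C%C <= `|a| * (opnorm f)%:C%C.
Proof.
rewrite -(RRe_real (normr_real a)) -realCM lecR; apply: opnorm_le => x x1.
rewrite realCM (RRe_real (normr_real a)) normrZ ler_wpM2l//.
by rewrite (le_trans (le_opnorm _ _))// ler_piMr// lecR opnorm_ge0.
Qed.

Fact opnormZ (a : R[i]) f : (opnorm (a *: f))%:C%C = `|a| * (opnorm f)%:C%C.
Proof.
apply/eqP; rewrite eq_le opnormZ_le /=.
have [->|a0] := eqVneq a 0.
  by rewrite normr0 mul0r lecR opnorm_ge0.
rewrite -ler_pdivlMl ?normr_gt0// -normfV.
by rewrite -[X in (opnorm X)%:C%C](scalerK a0) opnormZ_le.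
Qed.

Fact opnorm_eq0 f : (opnorm f)%:C%C = 0 :> R[i] -> f = 0.
Proof.
move=> f0; apply: bopP => x; apply/eqP; rewrite -normr_le0.
by rewrite (le_trans (le_opnorm f x))// f0 mul0r.
Qed.

HB.instance Definition _ := Lmodule_isNormed.Build R[i] bop
  opnormD opnormZ opnorm_eq0.

Definition is_adjoint f g : Prop :=
  forall x y, inner (f x) y = inner x (g y).

(* The unique adjoint, which exists by the Riesz representation theorem. *)
Definition adjoint f : bop := xget 0 [set g | is_adjoint f g].

Definition normal_op f : Prop := adjoint f * f = f * adjoint f.

Definition is_orthogonal_projection (V : set H) (p : bop) : Prop :=
  forall x, V (p x) /\ (forall y, V y -> inner (x - p x) y = 0).

(* For a closed subspace V this is the unique orthogonal projection onto V,
   which exists by the projection theorem. *)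
Definition orthogonal_projection (V : set H) : bop :=
  xget 0 (is_orthogonal_projection V).

Definition range_projection f : bop := orthogonal_projection (closure (range f)).

Definition groupoid_orbit f : set bop :=
  [set v * f * adjoint v | v in [set v | adjoint v * v = range_projection f]].

Definition spectrum f : set R[i] :=
  [set z : R[i] | ~ exists g : bop, g * (f - z *: (1 : bop)) = 1 /\ (f - z *: (1 : bop)) * g = 1].

End BoundedOperators.

(* Main.v *)
Require Import Defs.
From mathcomp Require Import all_boot all_order all_algebra.
From mathcomp Require Import all_classical all_reals all_analysis.
From mathcomp Require Import complex.
From mathcomp Require Import lra ring.
Set Implicit Arguments.
Unset Strict Implicit.
Unset Printing Implicit Defensive.
Import Order.TTheory GRing.Theory Num.Theory.
Import numFieldNormedType.Exports.
Local Open Scope classical_set_scope.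
Local Open Scope ring_scope.

(** The spectrum of a normal operator [a] governs which normal operators are norm
    limits of its conjugates [v a v*], for [v] a partial isometry with initial
    space the closed range of [a]. The whole argument is carried by vectors and
    lower bounds; no spectral measure is constructed.

    The basic fact is [normal_peripheral]: a nonzero normal operator [N] is not
    bounded below after subtraction of some scalar of modulus its norm. Applied
    to inverses, it bounds [N - w] below by the distance from [w] to the
    spectrum, for [w] close to an isolated spectral value [c]. Averaging this
    estimate over four phases gives a gap ([spectral_gap]): [N - c] is bounded
    below on the complement of its kernel. Applied to a
    compression of [N], [normal_peripheral] also shows that if all nonzero
    spectral values are isolated, then the eigenvectors with nonzero eigenvalue
    span the closed range ([normal_eigen_complete]).

    If the spectrum accumulates only at 0, let [b] be a limit of conjugates of
    [a]. Lower bounds pass from [a] to its conjugates uniformly and then to [b],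
    so [b] is normal, its nonzero spectral values are isolated and both
    operators have spectral gaps. Conjugates close enough to [b] therefore match
    the eigenspaces of [a] and [b], eigenvalue by eigenvalue
    ([orbit_limit_bases]). By completeness of the eigenvectors the matching
    bases assemble into a partial isometry that carries [a] to [b].

    If the spectrum accumulates at [z] other than 0, there are orthonormal
    sequences of approximate eigenvectors for [z], orthogonal to the eigenspace
    [Z] of [z], with arbitrarily small total defect. Rerouting an isometry along
    such a sequence changes the conjugate of [a] almost as if [a] were the
    scalar [z] there ([conjugation_perturbation]). When [Z] is zero, a shift
    along the sequence frees one dimension, and the limit of the conjugates
    acquires the eigenvalue [z]. When [Z] is not zero, the sequence absorbs [Z],
    and the limit loses the eigenvalue [z]. Both limits lie outside the orbit,
    whose elements have the nonzero eigenvalues of [a]. *)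

(** * Norms as real numbers *)

Section RealNorm.
Context (R : realType).

(** The norm of a normed space over [R[i]] is a nonnegative real sitting inside
    [R[i]], whose order is only partial; its real part lives in the ordered
    field [R], where inequalities can be decided by linear arithmetic. *)
Definition nrm (V : normedZmodType R[i]) (x : V) : R := complex.Re `|x|.

Lemma nrmE (V : normedZmodType R[i]) (x : V) : `|x| = (nrm x)%:C%C.
Proof. by rewrite /nrm RRe_real// normr_real. Qed.

Lemma realC_inj (s t : R) : s%:C%C = t%:C%C :> R[i] -> s = t.
Proof. by move=> []. Qed.

Lemma realCX (s : R) n : (s ^+ n)%:C%C = s%:C%C ^+ n :> R[i].
Proof. exact: rmorphXn. Qed.

Section Zmod.
Context (V : normedZmodType R[i]).
Implicit Types x y : V.

Lemma nrm_ge0 x : 0 <= nrm x.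
Proof. by rewrite -lecR -nrmE normr_ge0. Qed.

Lemma nrm0 : nrm (0 : V) = 0.
Proof. by rewrite /nrm normr0. Qed.

Lemma nrm_eq0 x : (nrm x == 0) = (x == 0).
Proof.
apply/eqP/eqP => [x0|->]; last exact: nrm0.
by apply: normr0_eq0; rewrite nrmE x0.
Qed.

Lemma nrm_gt0 x : (0 < nrm x) = (x != 0).
Proof. by rewrite lt_neqAle nrm_ge0 andbT eq_sym nrm_eq0. Qed.

Lemma nrmN x : nrm (- x) = nrm x.
Proof. by rewrite /nrm normrN. Qed.

Lemma nrmC x y : nrm (x - y) = nrm (y - x).
Proof. by rewrite /nrm distrC. Qed.

Lemma nrmD x y : nrm (x + y) <= nrm x + nrm y.
Proof. by rewrite -lecR realCD -!nrmE ler_normD. Qed.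

Lemma nrmB x y : nrm (x - y) <= nrm x + nrm y.
Proof. by rewrite -lecR realCD -!nrmE ler_normB. Qed.

Lemma nrm_tri x y z : nrm (x - z) <= nrm (x - y) + nrm (y - z).
Proof. by rewrite -[x - z](subrKA y) nrmD. Qed.

Lemma nrm_le x y : nrm x <= nrm y + nrm (x - y).
Proof. by rewrite -[X in nrm X <= _](subrK y) addrC nrmD. Qed.

Lemma nrm_sum (I : Type) (r : seq I) (P : pred I) (F : I -> V) :
  nrm (\sum_(i <- r | P i) F i) <= \sum_(i <- r | P i) nrm (F i).
Proof.
elim/big_ind2: _ => [|x a y b xa yb|//]; first by rewrite nrm0.
by rewrite (le_trans (nrmD _ _))// lerD.
Qed.

(** The way limits enter: a vector is shown to vanish by bounding its norm by
    every positive real. *)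
Lemma nrm_small x : (forall e : R, 0 < e -> nrm x <= e) -> x = 0.
Proof.
move=> h; apply/eqP; rewrite -nrm_eq0 eq_le nrm_ge0 andbT.
by apply/ler_addgt0Pr => e e0; rewrite add0r h.
Qed.
End Zmod.

Implicit Types c d : R[i].

Lemma nrmM c d : nrm (c * d) = nrm c * nrm d.
Proof. by apply: realC_inj; rewrite realCM -!nrmE normrM. Qed.

Lemma nrmX c n : nrm (c ^+ n) = nrm c ^+ n.
Proof. by apply: realC_inj; rewrite realCX -!nrmE normrX. Qed.

Lemma nrmV c : nrm c^-1 = (nrm c)^-1.
Proof.
have [->|c0] := eqVneq c 0; first by rewrite invr0 nrm0 invr0.
have n0 : nrm c != 0 by rewrite nrm_eq0.
by apply: (mulIf n0); rewrite -nrmM !mulVf// /nrm normr1.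
Qed.

Lemma nrmZ (V : normedModType R[i]) c (x : V) : nrm (c *: x) = nrm c * nrm x.
Proof. by apply: realC_inj; rewrite realCM -!nrmE normrZ. Qed.

Lemma nrm1 : nrm (1 : R[i]) = 1.
Proof. by rewrite /nrm normr1. Qed.

Lemma nrm_real (t : R) : nrm (t%:C%C : R[i]) = `|t|.
Proof. by rewrite /nrm normc_def /= expr0n addr0 sqrtr_sqr. Qed.

Lemma nrm_i : nrm ('i%C : R[i]) = 1.
Proof. by rewrite /nrm normc_def /= expr0n add0r expr1n sqrtr1. Qed.

Lemma nrmJ c : nrm (Num.conj c) = nrm c.
Proof. by rewrite /nrm norm_conjC. Qed.

Lemma mulCJ c : c * Num.conj c = (nrm c ^+ 2)%:C%C.
Proof. by rewrite -normCK nrmE realCX. Qed.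

Lemma Re_le_nrm c : complex.Re c <= nrm c.
Proof.
by rewrite (le_trans (ler_norm _))// -lecR -nrmE normc_ge_Re.
Qed.

Lemma conj_realC (t : R) : Num.conj (t%:C%C : R[i]) = t%:C%C.
Proof. exact: conjc_real. Qed.

Lemma ReD c d : complex.Re (c + d) = complex.Re c + complex.Re d.
Proof. by case: c d => [? ?] [? ?]. Qed.

Lemma ReJ c : complex.Re (Num.conj c) = complex.Re c.
Proof. by case: c. Qed.

Lemma ReN c : complex.Re (- c) = - complex.Re c.
Proof. by case: c. Qed.

End RealNorm.

(** * Elementary geometry of the inner product *)

Section Inner.
Context (R : realType) (H : hilbertType R).
Implicit Types (x y z : H) (c : R[i]).

Lemma innerDl x y z : inner (x + y) z = inner x z + inner y z.
Proof. exact: linearDl. Qed.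
Lemma innerDr x y z : inner z (x + y) = inner z x + inner z y.
Proof. exact: linearDr. Qed.
Lemma innerNl x y : inner (- x) y = - inner x y.
Proof. exact: linearNl. Qed.
Lemma innerNr x y : inner x (- y) = - inner x y.
Proof. exact: linearNr. Qed.
Lemma innerBl x y z : inner (x - y) z = inner x z - inner y z.
Proof. exact: linearBl. Qed.
Lemma innerBr x y z : inner z (x - y) = inner z x - inner z y.
Proof. exact: linearBr. Qed.
Lemma inner0l x : inner 0 x = 0. Proof. exact: linear0l. Qed.
Lemma inner0r x : inner x 0 = 0. Proof. exact: linear0r. Qed.
Lemma innerZl c x y : inner (c *: x) y = c * inner x y.
Proof. exact: linearZl_LR. Qed.
Lemma innerZr c x y : inner x (c *: y) = Num.conj c * inner x y.
Proof. exact: linearZr_LR. Qed.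

Lemma innerC x y : inner x y = Num.conj (inner y x).
Proof. by rewrite hermC /= expr0 mul1r. Qed.

Lemma inner_suml (I : Type) (r : seq I) (P : pred I) (F : I -> H) y :
  inner (\sum_(i <- r | P i) F i) y = \sum_(i <- r | P i) inner (F i) y.
Proof. exact: linear_sumlz. Qed.

Lemma inner_eq0C x y : inner x y = 0 -> inner y x = 0.
Proof. by move=> h; rewrite innerC h rmorph0. Qed.

Lemma innerxx x : inner x x = (nrm x ^+ 2)%:C%C.
Proof. by rewrite -normr_inner nrmE realCX. Qed.

Lemma nrm2E x : nrm x ^+ 2 = complex.Re (inner x x).
Proof. by rewrite innerxx. Qed.

Lemma nrm2D x y :
  nrm (x + y) ^+ 2 = nrm x ^+ 2 + nrm y ^+ 2 + 2 * complex.Re (inner x y).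
Proof.
rewrite !nrm2E innerDl !innerDr !ReD.
by rewrite [in inner y x]innerC ReJ; ring.
Qed.

Lemma nrm2B x y :
  nrm (x - y) ^+ 2 = nrm x ^+ 2 + nrm y ^+ 2 - 2 * complex.Re (inner x y).
Proof. by rewrite nrm2D nrmN innerNr ReN mulrN. Qed.

Lemma pythagoras x y : inner x y = 0 ->
  nrm (x + y) ^+ 2 = nrm x ^+ 2 + nrm y ^+ 2.
Proof. by move=> h; rewrite nrm2D h /= mulr0 addr0. Qed.

Lemma parallelogram x y :
  nrm (x + y) ^+ 2 + nrm (x - y) ^+ 2 = 2 * (nrm x ^+ 2 + nrm y ^+ 2).
Proof. by rewrite nrm2D nrm2B; ring. Qed.

Lemma inner_self_eq0 x : inner x x = 0 -> x = 0.
Proof.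
rewrite innerxx => /(@realC_inj _ _ 0)/eqP.
by rewrite sqrf_eq0 nrm_eq0 => /eqP.
Qed.

(** The witness is the coefficient of the projection of [x] on the line through
    [y]; both the Cauchy-Schwarz inequality and the orthogonality in the
    projection theorem come from this value of the distance. *)
Lemma best_scalar x y : y != 0 -> exists c,
  nrm (x - c *: y) ^+ 2 = nrm x ^+ 2 - (nrm (inner x y) / nrm y) ^+ 2.
Proof.
move=> y0; have ny : 0 < nrm y by rewrite nrm_gt0.
exists (inner x y * ((nrm y)^-1 ^+ 2)%:C%C); set c := inner x y * _.
rewrite nrm2B nrmZ exprMn innerZr.
have -> : complex.Re (Num.conj c * inner x y) = (nrm (inner x y) / nrm y) ^+ 2.
  rewrite /c rmorphM /= mulrAC [Num.conj _ * inner x y]mulrC mulCJ mulrC conj_realC.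
  by rewrite -realCM /= exprMn mulrC.
by rewrite /c nrmM nrm_real ger0_norm ?sqr_ge0//; field; rewrite gt_eqF.
Qed.

Lemma cauchy_schwarz x y : nrm (inner x y) <= nrm x * nrm y.
Proof.
have [->|y0] := eqVneq y 0; first by rewrite inner0r !nrm0 mulr0.
have ny : 0 < nrm y by rewrite nrm_gt0.
have [c cE] := best_scalar x y0.
rewrite -ler_pdivrMr// -ler_sqr ?nnegrE ?divr_ge0 ?nrm_ge0//.
by rewrite -subr_ge0 -cE sqr_ge0.
Qed.
End Inner.

(** * Closure, limit points and completeness through real distances *)

Section Topology.
Context (R : realType).

Lemma gt0_realC (e : R[i]) : 0 < e -> exists2 t : R, 0 < t & e = t%:C%C.
Proof.
move=> e0; have eE : e = (complex.Re e)%:C%C by rewrite RRe_real// gtr0_real.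
by exists (complex.Re e) => //; rewrite -ltcR -eE.
Qed.

Section Normed.
Context (V : normedModType R[i]).

Lemma ball_nrm (x y : V) (t : R) : ball x t%:C%C y <-> nrm (x - y) < t.
Proof. by rewrite -ball_normE /= nrmE ltcR. Qed.

Lemma nbhs_nrm (x : V) (P : set V) :
  nbhs x P <-> exists2 e : R, 0 < e & forall y, nrm (x - y) < e -> P y.
Proof.
split=> [/nbhs_ballP[e /= /gt0_realC[t t0 ->] xP]|[e e0 xP]].
  by exists t => // y xy; apply: xP; apply/ball_nrm.
apply/nbhs_ballP; exists e%:C%C; first by rewrite /= ltcR.
by move=> y /ball_nrm; exact: xP.
Qed.

Lemma closure_nrm (A : set V) (x : V) :
  closure A x <-> forall e : R, 0 < e -> exists2 y, A y & nrm (x - y) < e.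
Proof.
split=> [xA e e0|xA B /nbhs_nrm[e e0 xB]].
  have [|y [Ay /= xy]] := xA [set y | nrm (x - y) < e]; last by exists y.
  by apply/nbhs_nrm; exists e.
by have [y Ay xy] := xA e e0; exists y; split=> //; exact: xB.
Qed.

Lemma dense_nrm (D : set V) :
  dense D -> forall (x : V) (e : R), 0 < e -> exists2 y, D y & nrm (x - y) < e.
Proof.
move=> dD x e e0.
have xO : (ball x e%:C%C)° !=set0.
  by exists x; apply/nbhs_ballP; exists e%:C%C => //=; rewrite ltcR.
have [y [/interior_subset/ball_nrm xy Dy]] := dD _ xO (@open_interior _ _).
by exists y.
Qed.
End Normed.

Lemma limit_point_nrm (A : set R[i]) (z : R[i]) :
  limit_point A z <-> forall e : R, 0 < e ->
    exists y, [/\ y != z, A y & nrm (z - y) < e].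
Proof.
split=> [zA e e0|zA B /nbhs_nrm[e e0 zB]].
  have [|y [yz Ay /= zy]] := zA [set y | nrm (z - y) < e]; last by exists y.
  by apply/nbhs_nrm; exists e.
by have [y [yz Ay zy]] := zA e e0; exists y; split=> //; exact: zB.
Qed.

Lemma cauchy_complete (H : hilbertType R) (u : nat -> H) :
  (forall e : R, 0 < e ->
    exists N, forall m n, (N <= m)%N -> (N <= n)%N -> nrm (u m - u n) < e) ->
  exists l, forall e : R, 0 < e ->
    exists N, forall n, (N <= n)%N -> nrm (u n - l) < e.
Proof.
move=> cu; have : cvg (u @ \oo).
  apply/cauchy_cvgP/cauchy_exP => e /gt0_realC[t t0 ->].
  have [N uN] := cu t t0; exists (u N); exists N => // n /= Nn.
  by apply/ball_nrm; exact: uN.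
move=> /cvg_ex[l ul]; exists l => e e0.
have [|N _ uN] := ul (ball l e%:C%C).
  by apply/nbhs_nrm; exists e => // y ?; apply/ball_nrm.
by exists N => n Nn; rewrite nrmC; apply/ball_nrm; exact: uN.
Qed.
End Topology.

(** * Closed subspaces and the projection theorem *)

Section Projection.
Context (R : realType) (H : hilbertType R).
Implicit Types (x y z : H) (c : R[i]) (V S : set H) (f g : bop H).

Lemma nrm_bopE f : nrm f = opnorm f.
Proof. by []. Qed.

Lemma nrm_bop f x : nrm (f x) <= nrm f * nrm x.
Proof. by rewrite -lecR realCM -!nrmE [`|f|]/(_%:C%C) le_opnorm. Qed.

Lemma nrm_bop_le f (M : R) : 0 <= M ->
  (forall x, nrm (f x) <= M * nrm x) -> nrm f <= M.
Proof.
move=> M0 fM; rewrite nrm_bopE; apply: opnorm_le => x x1.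
rewrite nrmE lecR (le_trans (fM x))// ler_piMr//.
by rewrite -lecR -nrmE.
Qed.

Lemma ex_bop (f : H -> H) (M : R) :
  (forall c x y, f (c *: x + y) = c *: f x + f y) ->
  (forall x, nrm (f x) <= M * nrm x) -> exists g : bop H, forall x, g x = f x.
Proof.
move=> lf fM; have fb : f \in @bounded_linear R H.
  apply/bounded_linearP; split; first exact: lf.
  by exists M => x; rewrite !nrmE -realCM lecR.
by exists (BOp fb).
Qed.

Lemma bopD f x y : f (x + y) = f x + f y. Proof. exact: linearD. Qed.
Lemma bopB f x y : f (x - y) = f x - f y. Proof. exact: linearB. Qed.
Lemma bopZ f c x : f (c *: x) = c *: f x. Proof. exact: linearZ. Qed.
Lemma bop0 f : f 0 = 0. Proof. exact: linear0. Qed.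
Lemma bopPP f c x y : f (c *: x + y) = c *: f x + f y.
Proof. exact: linearP. Qed.

Lemma bop_mulE f g x : (f * g) x = f (g x). Proof. by []. Qed.
Lemma bop_addE f g x : (f + g) x = f x + g x. Proof. by []. Qed.
Lemma bop_subE f g x : (f - g) x = f x - g x. Proof. by []. Qed.
Lemma bop_scaleE c f x : (c *: f) x = c *: f x. Proof. by []. Qed.
Lemma bop_oneE x : (1 : bop H) x = x. Proof. by []. Qed.
Lemma divS_gt0 (e t : R) : 0 < e -> 0 <= t -> 0 < e / (t + 1).
Proof. by move=> e0 t0; rewrite divr_gt0// ltr_wpDl. Qed.

Lemma mul_lt_divS (e t s : R) : 0 < e -> 0 <= t -> s < e / (t + 1) -> t * s < e.
Proof.
move=> e0 t0; have t1 : 0 < t + 1 by rewrite ltr_wpDl.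
by rewrite ltr_pdivlMr// => h; have [s0|s0] := leP 0 s; nra.
Qed.

Definition closed_subspace V : Prop :=
  [/\ V 0, forall c x y, V x -> V y -> V (c *: x + y) & closed V].

Definition orth S : set H := [set x | forall y, S y -> inner x y = 0].

Section Subspace.
Variables (V : set H) (sV : closed_subspace V).
Lemma subspace0 : V 0. Proof. by case: sV. Qed.
Lemma subspaceP c x y : V x -> V y -> V (c *: x + y).
Proof. by case: sV => _ + _; apply. Qed.
Lemma subspaceZ c x : V x -> V (c *: x).
Proof. by move=> Vx; rewrite -[_ *: _]addr0; apply: subspaceP => //; exact: subspace0. Qed.
Lemma subspaceD x y : V x -> V y -> V (x + y).
Proof. by move=> Vx Vy; rewrite -[x]scale1r; exact: subspaceP. Qed.
Lemma subspaceB x y : V x -> V y -> V (x - y).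
Proof. by move=> Vx Vy; rewrite addrC -scaleN1r; exact: subspaceP. Qed.
Lemma subspace_closed x :
  (forall e : R, 0 < e -> exists2 y, V y & nrm (x - y) < e) -> V x.
Proof. by case: sV => _ _ cV h; apply: cV; apply/closure_nrm. Qed.
End Subspace.

Lemma mk_closed_subspace V : V 0 -> (forall c x y, V x -> V y -> V (c *: x + y)) ->
  (forall x, (forall e : R, 0 < e -> exists2 y, V y & nrm (x - y) < e) -> V x) ->
  closed_subspace V.
Proof. by move=> V0 VP cV; split=> // x /closure_nrm; exact: cV. Qed.

Lemma orth_subspace S : closed_subspace (orth S).
Proof.
apply: mk_closed_subspace => [y _|c x y Sx Sy z Sz|x h y Sy].
- exact: inner0l.
- by rewrite innerDl innerZl Sx// Sy// mulr0 addr0.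
- apply: nrm_small => e e0.
  have [z Sz xz] := h _ (divS_gt0 e0 (nrm_ge0 y)).
  rewrite -[x](subrK z) innerDl Sz// addr0 (le_trans (cauchy_schwarz _ _))//.
  by rewrite mulrC ltW// mul_lt_divS// nrm_ge0.
Qed.

Lemma ker_subspace f : closed_subspace [set x | f x = 0].
Proof.
apply: mk_closed_subspace => [|c x y /= fx fy|x h] /=; first exact: bop0.
  by rewrite bopPP fx fy scaler0 addr0.
apply: nrm_small => e e0.
have [y /= fy xy] := h _ (divS_gt0 e0 (nrm_ge0 f)).
rewrite -[x](subrK y) bopD fy addr0 (le_trans (nrm_bop _ _))//.
by rewrite ltW// mul_lt_divS// nrm_ge0.
Qed.

(** Limits of linear combinations: the error on [x] has to be divided by
    [nrm c + 1], which stays positive when [c] is zero. *)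
Lemma closure_subspace S : S 0 ->
  (forall c x y, S x -> S y -> S (c *: x + y)) -> closed_subspace (closure S).
Proof.
move=> S0 SP; split; last exact: closed_closure.
  exact: subset_closure.
move=> c x y /closure_nrm xS /closure_nrm yS; apply/closure_nrm => e e0.
have e2 : 0 < e / 2 by rewrite divr_gt0.
have [u Su xu] := xS _ (divS_gt0 e2 (nrm_ge0 c)).
have [v Sv yv] := yS _ e2.
exists (c *: u + v); first exact: SP.
rewrite opprD addrACA -scalerBr (le_lt_trans (nrmD _ _))// nrmZ.
by rewrite [ltRHS](splitr e) ltrD// mul_lt_divS// nrm_ge0.
Qed.

Lemma closure_range_subspace f : closed_subspace (closure (range f)).
Proof.
apply: closure_subspace => [|c _ _ [x _ <-] [y _ <-]].
  by exists 0 => //; exact: bop0.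
by exists (c *: x + y) => //; exact: bopPP.
Qed.

Lemma subspaceI V W : closed_subspace V -> closed_subspace W ->
  closed_subspace (V `&` W).
Proof.
move=> sV sW; split; first by split; exact: subspace0.
  by move=> c x y [Vx Wx] [Vy Wy]; split; exact: subspaceP.
by apply: closedI; [case: sV|case: sW].
Qed.

Lemma inv_small (e : R) : 0 < e ->
  exists N, forall n, (N <= n)%N -> n.+1%:R^-1 < e.
Proof.
move=> e0; have [N _ h] := near_infty_natSinv_lt (PosNum e0).
by exists N => n Nn; exact: h.
Qed.

(** A minimizing sequence for the distance from [x] to [V] is Cauchy by the
    parallelogram law, because midpoints of elements of [V] stay in [V]. At the
    limit, moving along a line of [V] cannot decrease the distance, so
    [best_scalar] forces the residual to be orthogonal to [V]. *)
Theorem projection_theorem V : closed_subspace V ->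
  forall x, exists2 p, V p & orth V (x - p).
Proof.
move=> sV x; pose D := [set nrm (x - v) | v in V].
have lD : has_inf D.
  split; first by exists (nrm (x - 0)), 0 => //; exact: subspace0.
  by exists 0 => _ [v _ <-]; exact: nrm_ge0.
pose d := inf D.
have dle v : V v -> d <= nrm (x - v) by move=> Vv; apply: (ge_inf lD.2); exists v.
have d0 : 0 <= d by apply: lb_le_inf lD.1 _ => _ [v _ <-]; exact: nrm_ge0.
have /choice[v vP] n : exists v, V v /\ nrm (x - v) < d + n.+1%:R^-1.
  have [|_ [v Vv <-] vd] := @inf_adherent _ D n.+1%:R^-1 _ lD.
    by rewrite invr_gt0 ltr0n.
  by exists v.
have close m n (t : R) : 0 < t -> t <= 1 -> m.+1%:R^-1 < t -> n.+1%:R^-1 < t ->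
    nrm (v m - v n) ^+ 2 <= t * (8 * d + 4).
  move=> t0 t1 mt nt; have [Vm xm] := vP m; have [Vn xn] := vP n.
  have dd : d <= nrm (x - 2^-1 *: (v m + v n)).
    by apply: dle; apply: (subspaceZ sV); exact: (subspaceD sV).
  have E : nrm ((x - v m) + (x - v n)) = 2 * nrm (x - 2^-1 *: (v m + v n)).
    have -> : (x - v m) + (x - v n) = 2%:R%:C%C *: (x - 2^-1 *: (v m + v n)).
      rewrite scalerBr scalerA rmorph_nat mulfV ?pnatr_eq0// scale1r.
      by rewrite scaler_nat mulr2n addrACA opprD.
    by rewrite nrmZ nrm_real ger0_norm// ler0n.
  have F : (x - v m) - (x - v n) = v n - v m.
    by rewrite opprB addrC addrA subrK addrC.
  have := parallelogram (x - v m) (x - v n); rewrite E F [nrm (v n - _)]nrmC exprMn.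
  have h1 : nrm (x - v m) ^+ 2 <= (d + t) ^+ 2.
    by rewrite ler_sqr ?nnegrE ?nrm_ge0 ?addr_ge0// ?ltW// (lt_trans xm)// ltrD2l.
  have h2 : nrm (x - v n) ^+ 2 <= (d + t) ^+ 2.
    by rewrite ler_sqr ?nnegrE ?nrm_ge0 ?addr_ge0// ?ltW// (lt_trans xn)// ltrD2l.
  have h3 : d ^+ 2 <= nrm (x - 2^-1 *: (v m + v n)) ^+ 2.
    by rewrite ler_sqr ?nnegrE ?nrm_ge0.
  have : t ^+ 2 <= t by rewrite expr2 ler_piMl// ltW.
  move: h1 h2 h3; rewrite sqrrD; lra.
have [l lP] : exists l, forall e : R, 0 < e ->
    exists N, forall n, (N <= n)%N -> nrm (v n - l) < e.
  apply: cauchy_complete => e e0.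
  have D8 : 0 < 8 * d + 5 by lra.
  pose t := Num.min 1 (e ^+ 2 / (8 * d + 5)).
  have t0 : 0 < t by rewrite lt_min ltr01 divr_gt0 ?exprn_gt0.
  have [N NP] := inv_small t0; exists N => m n Nm Nn.
  have := close m n t t0; rewrite ge_min lexx NP// NP// => /(_ isT isT isT) h.
  have te : t * (8 * d + 5) <= e ^+ 2 by rewrite -ler_pdivlMr// ge_min lexx orbT.
  have : nrm (v m - v n) ^+ 2 < e ^+ 2 by nra.
  by rewrite ltr_sqr// nnegrE ?nrm_ge0 ?ltW.
have Vl : V l.
  apply: (subspace_closed sV) => e e0; have [N NP] := lP e e0.
  by exists (v N); [case: (vP N)|rewrite nrmC NP].
have xl : nrm (x - l) <= d.
  apply/ler_addgt0Pr => e e0.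
  have e2 : 0 < e / 2 by rewrite divr_gt0.
  have [N NP] := lP _ e2; have [M MP] := inv_small e2.
  have [_ h] := vP (maxn N M).
  have := nrm_tri x (v (maxn N M)) l.
  have := NP _ (leq_maxl N M); have := MP _ (leq_maxr N M).
  move: h; move: (_.+1%:R^-1) => t; lra.
exists l => // y Vy; have [->|y0] := eqVneq y 0; first exact: inner0r.
have [c cE] := best_scalar (x - l) y0.
have : d ^+ 2 <= nrm (x - l - c *: y) ^+ 2.
  rewrite ler_sqr ?nnegrE ?nrm_ge0//.
  rewrite -addrA -opprD; apply: dle; apply: (subspaceD sV) => //.
  exact: (subspaceZ sV).
have : nrm (x - l) ^+ 2 <= d ^+ 2 by rewrite ler_sqr ?nnegrE ?nrm_ge0.
rewrite cE => h1 h2.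
have : (nrm (inner (x - l) y) / nrm y) ^+ 2 <= 0 by lra.
rewrite -[_ <= 0]andTb -(sqr_ge0 (nrm (inner (x - l) y) / nrm y)) -eq_le eq_sym sqrf_eq0.
by rewrite mulf_eq0 invr_eq0 !nrm_eq0 (negbTE y0) orbF => /eqP.
Qed.
End Projection.

(** * Orthogonal projections, adjoints and normal operators *)

Section Adjoint.
Context (R : realType) (H : hilbertType R).
Implicit Types (x y z : H) (c d : R[i]) (V S : set H) (f g : bop H).

Local Notation proj := (@orthogonal_projection R H).

Lemma orth_meet V x : V x -> orth V x -> x = 0.
Proof. by move=> Vx /(_ x Vx); exact: inner_self_eq0. Qed.

Lemma proj_uniq V x p q : closed_subspace V ->
  V p -> orth V (x - p) -> V q -> orth V (x - q) -> p = q.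
Proof.
move=> sV Vp xp Vq xq; apply/eqP; rewrite -subr_eq0; apply/eqP.
apply: (@orth_meet V); first exact: (subspaceB sV).
have -> : p - q = (x - q) - (x - p) by rewrite opprB [RHS]addrC subrKA.
by apply: (subspaceB (orth_subspace V)).
Qed.

Section Projection.
Variables (V : set H) (sV : closed_subspace V).

Lemma projP : is_orthogonal_projection V (proj V).
Proof.
apply: xgetPex; have /choice[p pP] x : exists p, V p /\ orth V (x - p).
  by have [p] := projection_theorem sV x; exists p.
have [||g gE] := @ex_bop R H p 1.
- move=> c x y; have [[Vx xp] [Vy yp]] := (pP x, pP y).
  have [Vc cp] := pP (c *: x + y).
  apply: (proj_uniq sV Vc cp); first exact: (subspaceP sV).
  rewrite opprD addrACA -scalerBr.
  exact: (subspaceP (orth_subspace V)).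
- move=> x; have [Vx xp] := pP x; rewrite mul1r.
  rewrite -ler_sqr ?nnegrE ?nrm_ge0// -[x in leRHS](subrK (p x)).
  by rewrite pythagoras ?xp// lerDr sqr_ge0.
- by exists g => x; rewrite gE; case: (pP x).
Qed.

Lemma proj_in x : V (proj V x). Proof. by case: (projP x). Qed.

Lemma proj_orth x : orth V (x - proj V x).
Proof. by case: (projP x). Qed.

Lemma proj_eq x p : V p -> orth V (x - p) -> proj V x = p.
Proof. exact: (proj_uniq sV (proj_in x) (@proj_orth x)). Qed.

Lemma proj_id x : V x -> proj V x = x.
Proof. by move=> Vx; apply: proj_eq => //; rewrite subrr => y _; exact: inner0l. Qed.

Lemma proj_eq0 x : orth V x -> proj V x = 0.
Proof. by move=> Vx; apply: proj_eq; [exact: subspace0|rewrite subr0]. Qed.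

Lemma proj_adj x y : inner (proj V x) y = inner x (proj V y).
Proof.
have h u v : inner (proj V u) v = inner (proj V u) (proj V v).
  rewrite -{1}[v](subrK (proj V v)) innerDr [X in X + _]inner_eq0C ?add0r//.
  by apply: proj_orth; exact: proj_in.
by rewrite h innerC -h -innerC.
Qed.

Lemma nrm_proj x : nrm (proj V x) <= nrm x.
Proof.
rewrite -ler_sqr ?nnegrE ?nrm_ge0// -[x in leRHS](subrK (proj V x)).
by rewrite pythagoras ?lerDr ?sqr_ge0//; apply: proj_orth; exact: proj_in.
Qed.
End Projection.

(** The residual of [x] with respect to [V] is orthogonal to [V], hence to [x],
    hence to itself. *)
Lemma orth_orth V x : closed_subspace V -> orth (orth V) x -> V x.
Proof.
move=> sV Vx; rewrite -[x](subrK (proj V x)).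
have /= xo := proj_orth sV x; have /= xi := proj_in sV x.
suff -> : x - proj V x = 0 by rewrite add0r.
apply: inner_self_eq0; rewrite {1}innerBl Vx// (inner_eq0C (xo _ xi)) subr0//.
Qed.

(** The working principle for operator identities below: an identity is checked
    on a family of vectors and on its orthogonal complement. The kernel of the
    difference is a closed subspace containing both. *)
Lemma bop_eq_orth S f g :
  (forall x, S x -> f x = g x) -> (forall x, orth S x -> f x = g x) -> f = g.
Proof.
move=> fgS fgo; apply: bopP => x; apply/eqP; rewrite -subr_eq0 -bop_subE; apply/eqP.
have sK := ker_subspace (f - g); set K := [set _ | _] in sK.
rewrite -[x](subrK (proj K x)) bopD (proj_in sK x : (f - g) _ = 0) addr0.
rewrite bop_subE fgo ?subrr// => y Sy; apply: (proj_orth sK).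
by rewrite /K /= -[LHS]/(f y - g y) fgS ?subrr.
Qed.

(** The representing vector is a multiple of a vector orthogonal to the kernel,
    which exists by the projection theorem when the functional is not zero. *)
Lemma riesz (phi : H -> R[i]) (M : R) :
  (forall c x y, phi (c *: x + y) = c * phi x + phi y) ->
  (forall x, nrm (phi x) <= M * nrm x) -> exists u, forall x, phi x = inner x u.
Proof.
move=> lphi bphi.
have phi0 : phi 0 = 0.
  have := lphi 1 0 0; rewrite scaler0 addr0 mul1r => h.
  by apply: (@addrI _ (phi 0)); rewrite -h addr0.
have sK : closed_subspace [set x : H | phi x = 0].
  apply: mk_closed_subspace => [//|c x y /= x0 y0|x h] /=.
    by rewrite lphi x0 y0 mulr0 addr0.
  apply: nrm_small => e e0.
  have [y /= y0 xy] := h _ (divS_gt0 e0 (normr_ge0 M)).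
  rewrite -[x](subrK y) -[x - y]scale1r lphi y0 addr0 mul1r.
  rewrite (le_trans (bphi _))// (@le_trans _ _ (`|M| * nrm (x - y)))//.
    by rewrite ler_wpM2r ?nrm_ge0// ler_norm.
  by rewrite ltW// mul_lt_divS.
have [/existsNP[x0 x0P]|/contrapT z] := pselect (~ forall x, phi x = 0); last first.
  by exists 0 => x; rewrite z inner0r.
set K := [set _ | _] in sK.
pose q := x0 - proj K x0.
have Kq : orth K q := proj_orth sK x0.
have pq : phi q = phi x0.
  rewrite /q addrC -scaleN1r lphi (proj_in sK x0 : phi _ = 0).
  by rewrite mulr0 add0r.
have q0 : inner q q != 0.
  apply/eqP => /inner_self_eq0 q0; apply: x0P.
  by rewrite -pq q0 phi0.
exists (Num.conj (phi q / inner q q) *: q) => x.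
have /Kq : K ((- (phi x / phi q)) *: q + x).
  by rewrite /K /= lphi mulNr divfK ?addNr// pq; exact/eqP.
move/inner_eq0C; rewrite innerDl innerZl mulNr => /eqP; rewrite addrC subr_eq0 => /eqP h.
rewrite innerZr conjCK h mulrA mulrAC divfK//.
by rewrite mulrC divfK// pq; exact/eqP.
Qed.

Lemma inner_inj u v : (forall x, inner x u = inner x v) -> u = v.
Proof.
move=> h; apply/eqP; rewrite -subr_eq0; apply/eqP.
by apply: inner_self_eq0; rewrite innerBr h subrr.
Qed.

Lemma adjointP f : is_adjoint f (adjoint f).
Proof.
apply: xgetPex.
have /choice[g gP] y : exists u, forall x, inner (f x) y = inner x u.
  apply: (@riesz _ (nrm f * nrm y)) => [c x z|x].
    by rewrite bopPP innerDl innerZl.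
  rewrite (le_trans (cauchy_schwarz _ _))// mulrAC.
  by rewrite ler_wpM2r ?nrm_ge0// nrm_bop.
have [||h hE] := @ex_bop R H g (nrm f).
- move=> c x y; apply: inner_inj => z.
  by rewrite -gP !(innerDr, innerZr) !gP.
- move=> x; have [->|gx0] := eqVneq (g x) 0.
    by rewrite nrm0 mulr_ge0 ?nrm_ge0.
  have ng : 0 < nrm (g x) by rewrite nrm_gt0.
  rewrite -(ler_pM2r ng) -expr2 nrm2E -gP.
  rewrite (le_trans (Re_le_nrm _))// (le_trans (cauchy_schwarz _ _))//.
  by rewrite mulrAC ler_wpM2r ?nrm_ge0// nrm_bop.
- by exists h => x y; rewrite gP hE.
Qed.

Lemma adjE f x y : inner (f x) y = inner x (adjoint f y).
Proof. exact: adjointP. Qed.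

Lemma adjE2 f x y : inner (adjoint f x) y = inner x (f y).
Proof. by rewrite innerC -adjE -innerC. Qed.

Lemma adj_uniq f g : (forall x y, inner (f x) y = inner x (g y)) -> adjoint f = g.
Proof. by move=> h; apply: bopP => y; apply: inner_inj => x; rewrite -adjE h. Qed.

Lemma adjK f : adjoint (adjoint f) = f.
Proof. by apply: adj_uniq => x y; exact: adjE2. Qed.

Lemma adjM f g : adjoint (f * g) = adjoint g * adjoint f.
Proof. by apply: adj_uniq => x y; rewrite !bop_mulE !adjE. Qed.

Lemma adjD f g : adjoint (f + g) = adjoint f + adjoint g.
Proof. by apply: adj_uniq => x y; rewrite !bop_addE innerDl innerDr !adjE. Qed.

Lemma adjB f g : adjoint (f - g) = adjoint f - adjoint g.
Proof. by apply: adj_uniq => x y; rewrite !bop_subE innerBl innerBr !adjE. Qed.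

Lemma adjZ c f : adjoint (c *: f) = Num.conj c *: adjoint f.
Proof.
by apply: adj_uniq => x y; rewrite !bop_scaleE innerZl innerZr conjCK adjE.
Qed.

Lemma adj1 : adjoint (1 : bop H) = 1.
Proof. by apply: adj_uniq. Qed.

Lemma adj_proj V : closed_subspace V -> adjoint (proj V) = proj V.
Proof. by move=> sV; apply: adj_uniq; exact: proj_adj. Qed.

Lemma nrm_adj_le f : nrm (adjoint f) <= nrm f.
Proof.
apply: nrm_bop_le; first exact: nrm_ge0.
move=> x; have [->|gx0] := eqVneq (adjoint f x) 0.
  by rewrite nrm0 mulr_ge0 ?nrm_ge0.
have ng : 0 < nrm (adjoint f x) by rewrite nrm_gt0.
rewrite -(ler_pM2r ng) -expr2 nrm2E -adjE.
rewrite (le_trans (Re_le_nrm _))// (le_trans (cauchy_schwarz _ _))//.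
by rewrite mulrAC ler_wpM2r ?nrm_ge0// nrm_bop.
Qed.

Lemma nrm_adj f : nrm (adjoint f) = nrm f.
Proof.
by apply/eqP; rewrite eq_le nrm_adj_le -{1}[f]adjK nrm_adj_le.
Qed.

Lemma nrm_mul f g : nrm (f * g) <= nrm f * nrm g.
Proof.
apply: nrm_bop_le => [|x]; first by rewrite mulr_ge0 ?nrm_ge0.
rewrite bop_mulE (le_trans (nrm_bop _ _))// -mulrA ler_wpM2l ?nrm_ge0//.
exact: nrm_bop.
Qed.

(** Injectivity of the adjoint is density of the range. *)
Lemma adj_ker f x : adjoint f x = 0 <-> orth (range f) x.
Proof.
split=> [h _ [y _ <-]|h]; first by rewrite -adjE2 h inner0l.
by apply: inner_self_eq0; rewrite adjE2; apply: h; exists (adjoint f x).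
Qed.

(** Conversely, polarization in the real part shows that the two positive
    operators have the same real quadratic form, and the real part of the form
    at [u] and [u] is the full squared norm. *)
Lemma normal_nrmP f : normal_op f <-> forall x, nrm (adjoint f x) = nrm (f x).
Proof.
split=> [nf x|h].
  apply/eqP; rewrite -(eqrXn2 (n := 2)) ?nrm_ge0//.
  by rewrite !nrm2E adjE2 -bop_mulE -nf bop_mulE -adjE.
have h2 x y : complex.Re (inner ((adjoint f * f) x) y) =
    complex.Re (inner ((f * adjoint f) x) y).
  rewrite !bop_mulE adjE2 [in RHS]adjE.
  have := h (x + y); move/(congr1 (fun t => t ^+ 2)); rewrite !bopD !nrm2D !h; lra.
apply: bopP => x; apply/eqP; rewrite -subr_eq0; apply/eqP.
apply: inner_self_eq0; rewrite innerxx; congr (_%:C%C) => //.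
set u := _ - _; apply/eqP; rewrite nrm2E {1}/u innerBl ReD ReN h2 subrr//.
Qed.

Definition spectral_shift f c : bop H := f - c *: (1 : bop H).

Lemma spectral_shiftE f c x : spectral_shift f c x = f x - c *: x.
Proof. by []. Qed.

Lemma adj_shift f c : adjoint (spectral_shift f c) = spectral_shift (adjoint f) (Num.conj c).
Proof. by rewrite /spectral_shift adjB adjZ adj1. Qed.

Lemma shift_shift f c d : spectral_shift (spectral_shift f c) d = spectral_shift f (c + d).
Proof. by apply: bopP => x; rewrite !spectral_shiftE scalerDl opprD addrA. Qed.

Lemma normal_shift f c : normal_op f -> normal_op (spectral_shift f c).
Proof.
move=> /normal_nrmP nf; apply/normal_nrmP => x; rewrite adj_shift.
apply/eqP; rewrite -(eqrXn2 (n := 2)) ?nrm_ge0// !spectral_shiftE !nrm2B nf !nrmZ nrmJ.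
apply/eqP; congr (_ - 2 * _).
by rewrite !innerZr -ReJ rmorphM /= adjE2 [in LHS]innerC !conjCK.
Qed.
End Adjoint.

(** * Uniformity over the unit circle *)

Section CircleCompact.
Context (R : realType).

Lemma nrm_complex (a b : R) : nrm (a +i* b)%C ^+ 2 = a ^+ 2 + b ^+ 2.
Proof. by rewrite /nrm normc_def /= sqr_sqrtr// addr_ge0 ?sqr_ge0. Qed.

Lemma circle_compact : compact [set p : R * R | p.1 ^+ 2 + p.2 ^+ 2 = 1].
Proof.
have box : compact (`[(-1 : R), 1] `*` `[(-1 : R), 1]).
  by apply: compact_setX; exact: segment_compact.
apply: subclosed_compact box _.
- apply: (@preimage_closed _ _ (fun p : R * R => p.1 ^+ 2 + p.2 ^+ 2)
    [set t | t = 1]); last exact: closed_eq.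
  move=> p _.
  have h1 : (fun p : R * R => p.1) x @[x --> p] --> p.1 by exact: cvg_fst.
  have h2 : (fun p : R * R => p.2) x @[x --> p] --> p.2 by exact: cvg_snd.
  by apply: cvgD; rewrite expr2; under eq_fun do rewrite expr2; apply: cvgM.
- have sq (t : R) : t ^+ 2 <= 1 -> -1 <= t <= 1.
    by move=> t1; rewrite -ler_norml -(@expr_le1 _ 2)// real_normK ?num_real.
  move=> p /= p1; rewrite !in_itv /=; split; apply: sq.
    by rewrite -p1 lerDl sqr_ge0.
  by rewrite -p1 lerDr sqr_ge0.
Qed.

(** A property that holds locally uniformly near every point of the unit circle
    holds uniformly. The circle is treated as a compact subset of the plane
    [R * R]. *)
Lemma circle_uniform (Q : R[i] -> R -> Prop) :
  (forall w, nrm w = 1 -> exists2 e : R, 0 < e &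
     forall w' c, nrm (w - w') < e -> 0 < c -> c < e -> Q w' c) ->
  exists2 c : R, 0 < c & forall w, nrm w = 1 -> Q w c.
Proof.
move=> hQ; have /compact_near_coveringP cc := circle_compact.
have [|r /= r0 rP] := cc R (0 : R)^'+ (fun c p => Q (p.1 +i* p.2)%C c) _ _.
  move=> [a b] /= ab.
  have [|e e0 eQ] := hQ (a +i* b)%C.
    by apply/eqP; rewrite -(eqrXn2 (n := 2)) ?nrm_ge0// nrm_complex ab expr1n.
  have e2 : 0 < e / 2 by rewrite divr_gt0.
  exists (ball (a, b) (e / 2), [set c : R | 0 < c < e]) => /=.
    split; first exact: nbhsx_ballx.
    by near=> c; apply/andP; split; near: c; [exact: nbhs_right_gt|exact: nbhs_right_lt].
  move=> [[a' b'] c] /= [[/= aa bb] /andP[c0 ce]].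
  apply: eQ => //; rewrite -ltr_sqr ?nnegrE ?nrm_ge0 ?ltW//.
  rewrite -[(_ - _)]/((a - a') +i* (b - b'))%C nrm_complex.
  have sq t : `|t| < e / 2 -> t ^+ 2 < (e / 2) ^+ 2.
    by move=> te; rewrite -[ltLHS]real_normK ?num_real// ltr_sqr// nnegrE ltW.
  have := sq _ aa; have := sq _ bb; have := sqr_ge0 e; rewrite expr_div_n; lra.
have r2 : 0 < r / 2 by rewrite divr_gt0.
exists (r / 2) => // w w1; have := rP (r / 2); case: w w1 => a b w1 h.
apply: (h _ _ (a, b)) => //=; last by rewrite -nrm_complex w1 expr1n.
by rewrite sub0r normrN gtr0_norm// ltr_pdivrMr// ltr_pMr// ltr1n.
Unshelve. all: by end_near. Qed.
End CircleCompact.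

(** * Parseval's inequality over dyadic roots *)

Section Parseval.
Context (R : realType) (H : hilbertType R).
Implicit Types (x y z : H) (c d w : R[i]) (f g U : bop H).

(** The [2 ^ m] roots [t] of [c] average the squared norm of the sum exactly to
    the sum of the squared norms, so one root does at least as well. The root is
    found one binary digit at a time: the parallelogram law decides which of the
    two square roots of [c] to follow. *)
Lemma dyadic_parseval m c (u : nat -> H) : nrm c = 1 ->
  exists2 t, t ^+ (2 ^ m) = c &
  \sum_(k < 2 ^ m) nrm (u k) ^+ 2 <= nrm (\sum_(k < 2 ^ m) t ^+ k *: u k) ^+ 2.
Proof.
elim: m c u => [|m IH] c u c1.
  by exists c; rewrite ?expr1// expn0 !big_ord1 expr0 scale1r.
have [s sc] : exists s, s ^+ 2 = c by exists (sqrtC c); exact: sqrtCK.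
have s1 : nrm s = 1.
  by apply/eqP; rewrite -(eqrXn2 (n := 2)) ?nrm_ge0// -nrmX sc c1 expr1n.
have [d d2 [d1 dP]] : exists2 d, d ^+ 2 = c & nrm d = 1 /\
    \sum_(k < 2 ^ m.+1) nrm (u k) ^+ 2 <=
    \sum_(k < 2 ^ m) nrm (u k + d *: u (k + 2 ^ m)%N) ^+ 2.
  have E : 2 * \sum_(k < 2 ^ m.+1) nrm (u k) ^+ 2 =
      \sum_(k < 2 ^ m) nrm (u k + s *: u (k + 2 ^ m)%N) ^+ 2 +
      \sum_(k < 2 ^ m) nrm (u k + (- s) *: u (k + 2 ^ m)%N) ^+ 2.
    rewrite expnS mul2n -addnn big_split_ord /= -big_split -big_split /= mulr_sumr.
    apply: eq_bigr => k _; rewrite scaleNr parallelogram nrmZ s1 mul1r.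
    by rewrite [(2 ^ m + k)%N]addnC.
  have [h|h] := leP (\sum_(k < 2 ^ m.+1) nrm (u k) ^+ 2)
      (\sum_(k < 2 ^ m) nrm (u k + s *: u (k + 2 ^ m)%N) ^+ 2).
    by exists s.
  by exists (- s); rewrite ?sqrrN// nrmN; split=> //; lra.
have [t td tP] := IH d (fun k => u k + d *: u (k + 2 ^ m)%N) d1.
exists t; first by rewrite expnSr exprM td d2.
rewrite (le_trans dP)// (le_trans tP)//.
rewrite expnS mul2n -addnn big_split_ord /= -big_split /=.
rewrite le_eqVlt; apply/orP; left; apply/eqP; congr (nrm _ ^+ 2).
apply: eq_bigr => k _; rewrite scalerDr scalerA exprD td mulrC.
by rewrite [(2 ^ m + k)%N]addnC.
Qed.
End Parseval.

(** * A normal operator is singular somewhere on its peripheral circle *)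

Section Normaloid.
Context (R : realType) (H : hilbertType R).
Implicit Types (x y z : H) (c d w : R[i]) (f g U N T : bop H).

(** For a normal operator this is invertibility, and it is the form in which
    points outside the spectrum are used. *)
Definition bounded_below f := exists2 c : R, 0 < c & forall x, c * nrm x <= nrm (f x).

(** The norms of the iterates of a normal operator form a logarithmically convex
    sequence, so their ratios can only grow. *)
Lemma normal_log_convex N x : normal_op N -> nrm (N x) ^+ 2 <= nrm x * nrm (N (N x)).
Proof.
move=> /normal_nrmP nN; rewrite nrm2E adjE -nN.
by rewrite (le_trans (Re_le_nrm _))// cauchy_schwarz.
Qed.

Lemma normal_iter_ge N (s : R) x : normal_op N -> 0 < s -> 0 < nrm x ->
  s * nrm x <= nrm (N x) -> forall k, s ^+ k * nrm x <= nrm (iter k N x).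
Proof.
move=> nN s0 x0 sN.
have step k : 0 < nrm (iter k N x) /\ s * nrm (iter k N x) <= nrm (iter k.+1 N x).
  elim: k => [//|k [pk sk]].
  have pk1 : 0 < nrm (iter k.+1 N x) by rewrite (lt_le_trans _ sk)// mulr_gt0.
  split=> //; have := normal_log_convex (iter k N x) nN.
  rewrite -!iterS expr2 => h.
  rewrite -(ler_pM2l pk) mulrCA mulrA (le_trans _ h)//.
  by rewrite ler_wpM2r// ltW.
elim=> [|k IH]; first by rewrite mul1r.
rewrite exprS -mulrA (le_trans _ (step k).2)//.
by rewrite ler_wpM2l// ltW.
Qed.

Lemma bernoulli_inequality (t : R) n : 0 <= t <= 1 -> 1 - n%:R * t <= (1 - t) ^+ n.
Proof.
move=> /andP[t0 t1]; elim: n => [|n IH]; first by rewrite mul0r subr0.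
have n0 : 0 <= n%:R :> R by rewrite ler0n.
have : (1 - n%:R * t) * (1 - t) <= (1 - t) ^+ n * (1 - t).
  by rewrite ler_wpM2r// subr_ge0.
rewrite exprSr -natr1; nra.
Qed.

Lemma near_norming f (s : R) : 0 <= s -> s < nrm f -> exists2 x, nrm x = 1 & s <= nrm (f x).
Proof.
move=> s0 sf; apply: contrapT => /forallPNP h.
have : nrm f <= s.
  apply: nrm_bop_le => // x; have [->|x0] := eqVneq x 0.
    by rewrite bop0 !nrm0 mulr0.
  have nx : 0 < nrm x by rewrite nrm_gt0.
  have := h ((nrm x)^-1%:C%C *: x); rewrite bopZ !nrmZ nrm_real gtr0_norm ?invr_gt0//.
  rewrite mulVf ?gt_eqF// => /(_ erefl)/negP; rewrite -ltNge => /ltW.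
  by rewrite mulrC ler_pdivrMr.
by rewrite leNgt sf.
Qed.

Lemma iter_le f x k : nrm f <= 1 -> nrm (iter k f x) <= nrm x.
Proof.
move=> f1; elim: k => [//|k IH]; rewrite iterS (le_trans (nrm_bop _ _))//.
by rewrite (le_trans _ IH)// ler_piMl ?nrm_ge0.
Qed.

(** Elementary substitute for the spectral radius formula. Take [x] so nearly
    norming that the first [K] iterates of [U] at [x] keep squared norm at least
    one half. With [t] a [K]-th root of unity, the sum [y] of the
    [t ^+ k *: iter k U x] telescopes under [t *: U - 1] to a vector of norm at
    most 2, whereas Parseval makes the squared norm of [y] at least [K / 2] for
    a suitable [t]. *)
Lemma normal_almost_peripheral U (M : R) : normal_op U -> nrm U = 1 -> 0 < M ->
  exists w y, [/\ nrm w = 1, 0 < nrm y & M * nrm (spectral_shift U w y) <= nrm y].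
Proof.
move=> nU U1 M0; pose m := Num.bound (8 * M ^+ 2).
pose K := (2 ^ m)%N; have K0 : 0 < K%:R :> R by rewrite ltr0n expn_gt0.
have KM : 8 * M ^+ 2 < K%:R.
  have M8 : 0 <= 8 * M ^+ 2 by rewrite mulr_ge0 ?sqr_ge0.
  by apply: lt_trans (archi_boundP M8) _; rewrite ltr_nat ltn_expl.
(* With this defect, 2 * K factors 1 - h lose at most one half, by the
   Bernoulli inequality. *)
pose h : R := (4 * K%:R)^-1.
have K1 : 1 <= K%:R :> R by rewrite ler1n expn_gt0.
have h0 : 0 < h by rewrite invr_gt0 mulr_gt0.
have hK : K%:R * h = 4^-1 by rewrite /h invfM mulrCA divff ?gt_eqF// mulr1.
have h1 : h <= 4^-1 by rewrite -hK ler_peMl ?(ltW h0).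
have [hp hlt] : 0 <= 1 - h /\ 1 - h < nrm U.
  by rewrite U1; move: h0 h1; clearbody h => *; split; lra.
have [x x1 xU] := near_norming hp hlt.
have itx k : (k <= K)%N -> 2^-1 <= nrm (iter k U x) ^+ 2.
  move=> kK; have := @normal_iter_ge U (1 - h) x nU; rewrite x1 mulr1.
  have -> : 0 < 1 - h by lra.
  move=> /(_ isT ltr01 xU k); rewrite mulr1.
  have : 1 - k%:R * h <= (1 - h) ^+ k by apply: bernoulli_inequality; lra.
  have : k%:R * h <= K%:R * h by rewrite ler_wpM2r ?ler_nat// ltW.
  rewrite hK; nra.
have [t tK tP] := dyadic_parseval m (fun k => iter k U x) (nrm1 R).
set y := (X in _ <= nrm X ^+ 2) in tP.
have t1 : nrm t = 1.
  apply/eqP; rewrite -(@expr1n R K) -(eqrXn2 (n := K)) ?expn_gt0 ?nrm_ge0 ?expr1n//.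
  by rewrite -nrmX tK nrm1.
have t0 : t != 0 by rewrite -nrm_eq0 t1 oner_eq0.
have yK : K%:R / 2 <= nrm y ^+ 2.
  apply: le_trans tP; rewrite mulr_natl -[X in _ *+ X]card_ord -sumr_const.
  by apply: ler_sum => k _; apply: itx; exact: ltnW.
(* Since t ^+ K = 1, only the two ends of the telescoping sum survive. *)
have tel : t *: U y - y = t ^+ K *: iter K U x - x.
  rewrite /y linear_sum /= scaler_sumr -sumrB.
  under eq_bigr => k _.
    rewrite bopZ scalerA -exprS -iterS.
    over.
  by rewrite -(big_mkord xpredT (fun k => t ^+ k.+1 *: iter k.+1 U x - t ^+ k *: iter k U x)) telescope_sumr// expr0 scale1r.
exists t^-1, y; split.
- by rewrite nrmV t1 invr1.
- by rewrite nrm_gt0; apply/eqP => y0; move: yK; rewrite y0 nrm0 expr0n /=; lra.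
have -> : nrm (spectral_shift U t^-1 y) = nrm (t *: U y - y).
  have -> : t *: U y - y = t *: spectral_shift U t^-1 y.
    by rewrite spectral_shiftE scalerBr scalerA mulfV// scale1r.
  by rewrite nrmZ t1 mul1r.
have : nrm (t *: U y - y) <= 2.
  rewrite tel (le_trans (nrmB _ _))// nrmZ nrmX t1 expr1n mul1r.
  by rewrite (_ : 2 = 1 + 1)// lerD ?x1// -x1 iter_le// U1.
have : 0 <= nrm (t *: U y - y) by exact: nrm_ge0.
set p := nrm (_ - _) => p0 p2.
have My : (2 * M) ^+ 2 <= nrm y ^+ 2 by rewrite exprMn; lra.
have : 2 * M <= nrm y by move: My; rewrite ler_sqr// nnegrE ?nrm_ge0// mulr_ge0// ltW.
nra.
Qed.

(** Lower bounds are Lipschitz in the spectral parameter. *)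
Lemma bounded_below_near f w w' (c : R) :
  (forall x, c * nrm x <= nrm (spectral_shift f w x)) ->
  forall x, (c - nrm (w - w')) * nrm x <= nrm (spectral_shift f w' x).
Proof.
move=> fc x; rewrite mulrBl lerBlDr (le_trans (fc x))//.
rewrite (le_trans (nrm_le _ (spectral_shift f w' x)))// lerD2l !spectral_shiftE opprB addrC subrKA.
by rewrite -scalerBl nrmZ nrmC.
Qed.

(** If every point of the circle of radius [nrm N] had a lower bound, compactness
    would give a common one, against [normal_almost_peripheral]. *)
Theorem normal_peripheral N : normal_op N -> 0 < nrm N ->
  exists2 w, nrm w = nrm N & ~ bounded_below (spectral_shift N w).
Proof.
move=> nN N0; apply: contrapT => /forallPNP hN.
pose r := nrm N; pose U : bop H := r^-1%:C%C *: N.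
have r0 : r%:C%C != 0 :> R[i] by rewrite -nrm_eq0 nrm_real gtr0_norm ?gt_eqF.
have nU : normal_op U.
  apply/normal_nrmP => x; rewrite /U adjZ !bop_scaleE !nrmZ nrmJ.
  by have /normal_nrmP -> := nN.
have U1 : nrm U = 1 by rewrite /U nrmZ nrm_real gtr0_norm ?invr_gt0// mulVf// gt_eqF.
have shU w x : nrm (spectral_shift N (r%:C%C * w) x) = r * nrm (spectral_shift U w x).
  rewrite -[r in RHS](@gtr0_norm _ r)// -nrm_real -nrmZ; congr nrm.
  by rewrite !spectral_shiftE scalerBr !scalerA -realCM divff ?gt_eqF// scale1r.
have [|c c0 cP] := @circle_uniform R (fun w (c : R) => forall x, c * nrm x <= nrm (spectral_shift U w x)).
  move=> w w1; have /contrapT[c c0 cP] : ~ ~ bounded_below (spectral_shift N (r%:C%C * w)).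
    by apply: hN; rewrite nrmM nrm_real w1 mulr1 gtr0_norm.
  have cU x : c / r * nrm x <= nrm (spectral_shift U w x).
    by rewrite mulrAC ler_pdivrMr// [leRHS]mulrC -shU; exact: cP.
  exists (c / r / 2); first by rewrite !divr_gt0.
  move=> w' d ww d0 de x; apply: le_trans _ (bounded_below_near w' cU x).
  by rewrite ler_wpM2r ?nrm_ge0//; lra.
have [|w [y [w1 y0]]] := @normal_almost_peripheral U (2 / c) nU U1.
  by rewrite divr_gt0.
have := cP w w1 y; rewrite mulrAC ler_pdivrMr// => h1 h2; nra.
Qed.
End Normaloid.

(** * Isolated spectral values and completeness of eigenvectors *)

Section Gap.
Context (R : realType) (H : hilbertType R).
Implicit Types (x y : H) (c d w : R[i]) (f g U N T : bop H) (V S : set H).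

Local Notation proj := (@orthogonal_projection R H).

(** A lower bound on [V] makes preimages of a Cauchy sequence Cauchy. *)
Lemma closed_image V f (c : R) : closed_subspace V -> 0 < c ->
  (forall x, V x -> c * nrm x <= nrm (f x)) -> closed_subspace (f @` V).
Proof.
move=> sV c0 fc; apply: mk_closed_subspace.
- by exists 0; [exact: subspace0|rewrite bop0].
- move=> d _ _ [x Vx <-] [y Vy <-]; exists (d *: x + y); last by rewrite bopPP.
  exact: (subspaceP sV).
move=> y hy.
have /choice[x xP] n : exists x, V x /\ nrm (y - f x) < n.+1%:R^-1.
  have [|_ [x Vx <-] yx] := hy n.+1%:R^-1; first by rewrite invr_gt0 ltr0n.
  by exists x.
have lim (e : R) : 0 < e -> exists n0, forall n, (n0 <= n)%N -> nrm (y - f (x n)) < e.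
  move=> e0; have [n0 h] := inv_small e0; exists n0 => n nn.
  by rewrite (lt_trans (xP n).2)// h.
have [l lP] : exists l, forall e : R, 0 < e ->
    exists n0, forall n, (n0 <= n)%N -> nrm (x n - l) < e.
  apply: cauchy_complete => e e0.
  have [n0 nP] := lim (c * e / 2) (divr_gt0 (mulr_gt0 c0 e0) (ltr0Sn _ 1)).
  exists n0 => m n nm nn; rewrite -(ltr_pM2l c0).
  rewrite (le_lt_trans (fc _ _))//.
    by apply: (subspaceB sV); [case: (xP m)|case: (xP n)].
  rewrite bopB (le_lt_trans (nrm_tri _ y _))// nrmC.
  by rewrite [ltRHS]splitr ltrD// nP.
have Vl : V l.
  apply: (subspace_closed sV) => e /lP[n0 h].
  by exists (x n0); [case: (xP n0)|rewrite nrmC h].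
exists l => //; apply/eqP; rewrite -subr_eq0; apply/eqP; apply: nrm_small => e e0.
have e2 : 0 < e / 2 by rewrite divr_gt0.
have [n1 h1] := lim _ e2; have [n2 h2] := lP _ (divS_gt0 e2 (nrm_ge0 f)).
have := h1 _ (leq_maxl n1 n2); have := h2 _ (leq_maxr n1 n2).
move: (maxn _ _) => n hl hy'.
rewrite (le_trans (nrm_tri _ (f (x n)) _))// [leRHS]splitr lerD//; last first.
  by rewrite nrmC ltW.
by rewrite -bopB (le_trans (nrm_bop _ _))// ltW// mul_lt_divS ?nrm_ge0// nrmC.
Qed.

Lemma setT_subspace : closed_subspace [set: H].
Proof. by split => //; exact: closedT. Qed.

(** The range is closed by the lower bound and dense because the adjoint has the
    same kernel. *)
Lemma normal_invertible f : normal_op f -> bounded_below f ->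
  exists g, g * f = 1 /\ f * g = 1.
Proof.
move=> nf [c c0 fc]; have sR := closed_image setT_subspace c0 (fun x _ => fc x).
have inj x : f x = 0 -> x = 0.
  move=> fx; apply/eqP; rewrite -nrm_eq0 eq_le nrm_ge0 andbT.
  by rewrite -(ler_pM2l c0) mulr0 (le_trans (fc x))// fx nrm0.
have /choice[g gP] y : exists x, f x = y.
  have : adjoint f (y - proj (range f) y) = 0.
    by apply/adj_ker; exact: proj_orth.
  move=> h; have : nrm (f (y - proj (range f) y)) = 0.
    by rewrite -((normal_nrmP f).1 nf) h nrm0.
  move/eqP; rewrite nrm_eq0 => /eqP/inj/eqP; rewrite subr_eq0 => /eqP ->.
  by have [x _ <-] := proj_in sR y; exists x.
have gf x : g (f x) = x.
  by apply/eqP; rewrite -subr_eq0; apply/eqP/inj; rewrite bopB gP subrr.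
have [||h hE] := @ex_bop R H g c^-1.
- move=> d x y; apply/eqP; rewrite -subr_eq0; apply/eqP/inj.
  by rewrite bopB bopPP !gP subrr.
- by move=> x; rewrite mulrC ler_pdivlMr// mulrC -[x in leRHS]gP.
by exists h; split; apply: bopP => x; rewrite bop_mulE bop_oneE hE ?gf// gP.
Qed.

Lemma spectrumP f z : normal_op f -> spectrum f z <-> ~ bounded_below (spectral_shift f z).
Proof.
move=> nf; split=> [h /(normal_invertible (normal_shift z nf))//|h [g [gf _]]].
apply: h; have g1 : 0 < nrm g + 1 by rewrite ltr_wpDl// nrm_ge0.
exists (nrm g + 1)^-1; first by rewrite invr_gt0.
move=> x; rewrite mulrC ler_pdivrMr// mulrC.
have -> : nrm x = nrm ((g * spectral_shift f z) x) by rewrite gf bop_oneE.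
by rewrite bop_mulE (le_trans (nrm_bop _ _))// ler_wpM2r ?nrm_ge0// lerDl.
Qed.

Lemma normal_inverse f g : normal_op f -> g * f = 1 -> f * g = 1 -> normal_op g.
Proof.
rewrite /normal_op => nf gf fg.
have fg' : adjoint g * adjoint f = 1 by rewrite -adjM fg adj1.
have gf' : adjoint f * adjoint g = 1 by rewrite -adjM gf adj1.
rewrite -[RHS]mulr1 -[1 in RHS](_ : (f * adjoint f) * (adjoint g * g) = 1).
  by rewrite -nf !mulrA -[g * adjoint g * adjoint f]mulrA fg' mulr1 gf mul1r.
by rewrite mulrA -[f * _ * _]mulrA gf' mulr1 fg.
Qed.

(** Separates, in the expansion of a quadratic form along the phase [c] with
    conjugate [k], the term that is independent of the phase. *)
Lemma phase_expansion (K : comPzRingType) (P Q k c a1 a2 a3 a4 : K) :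
  c * k = 1 -> P * Q = 1 ->
  P * k * (a1 + Q * k * a2 + (Q * c * a3 + Q * c * (Q * k * a4))) =
  a3 + (k * (P * a1 + Q * a4) + k ^+ 2 * a2).
Proof.
move=> ck PQ; transitivity (P * k * a1 + (P * Q) * k ^+ 2 * a2 +
  (P * Q) * (c * k) * a3 + (P * Q) * (c * k) * Q * k * a4); first by ring.
by rewrite ck PQ; ring.
Qed.

Section Punctured.
Variables (T : bop H) (rho : R).
Hypotheses (nT : normal_op T) (rho0 : 0 < rho).
Hypothesis Trho : forall w, 0 < nrm w -> nrm w < rho -> bounded_below (spectral_shift T w).

(** For [w] close to 0, no spectral value is closer to [w] than 0 is. The inverse
    of [T - w] is normal, hence singular at some [u] with modulus its norm;
    then [T] is singular at [w + u^-1], which is 0 or has modulus at least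
    [rho]. In both cases [u^-1] has modulus at least [nrm w]. *)
Lemma punctured_resolvent w : nrm w < rho / 2 ->
  forall x, nrm w * nrm x <= nrm (spectral_shift T w x).
Proof.
move=> wr x; have [w0|w0] := eqVneq w 0; first by rewrite w0 nrm0 mul0r nrm_ge0.
have nw : 0 < nrm w by rewrite nrm_gt0.
have nS := normal_shift w nT.
have bS : bounded_below (spectral_shift T w) by apply: Trho => //; lra.
have [g [gS Sg]] := normal_invertible nS bS.
have xg : nrm x <= nrm g * nrm (spectral_shift T w x).
  by rewrite -[x in leLHS]bop_oneE -gS bop_mulE nrm_bop.
have [g0|g0] := leP (nrm g) 0.
  have : nrm x <= 0 by rewrite (le_trans xg)// mulr_le0_ge0 ?nrm_ge0.
  move=> x0; rewrite (le_trans _ (nrm_ge0 _))// mulr_ge0_le0//; exact: ltW.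
have [u uE nu] := normal_peripheral (normal_inverse nS gS Sg) g0.
have u0 : u != 0 by rewrite -nrm_gt0 uE.
(* The identity g - u = - u (T - w - u^-1) g moves singularity from g to T. *)
have sng : ~ bounded_below (spectral_shift T (w + u^-1)).
  move=> [c c0 hc]; apply: nu.
  have S1 : 0 < nrm (spectral_shift T w) + 1 by rewrite ltr_wpDl// nrm_ge0.
  exists (nrm u * c / (nrm (spectral_shift T w) + 1)); first by rewrite divr_gt0 ?mulr_gt0// uE.
  move=> y; rewrite mulrAC ler_pdivrMr//.
  have -> : spectral_shift g u y = (- u) *: spectral_shift T (w + u^-1) (g y).
    rewrite -shift_shift (spectral_shiftE (spectral_shift T w)) -bop_mulE Sg bop_oneE scalerBr scalerA.
    by rewrite mulNr mulfV// scaleN1r opprK scaleNr addrC.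
  rewrite nrmZ nrmN -!mulrA ler_wpM2l ?nrm_ge0//.
  apply: (@le_trans _ _ (c * (nrm (g y) * (nrm (spectral_shift T w) + 1)))).
    apply: ler_wpM2l; first exact: ltW.
    have {1}-> : y = spectral_shift T w (g y) by rewrite -bop_mulE Sg.
    rewrite mulrC (le_trans (nrm_bop _ _))// ler_wpM2r ?nrm_ge0//.
    by rewrite lerDl.
  by rewrite mulrA ler_wpM2r ?(ltW S1).
have wu : nrm w <= nrm u^-1.
  rewrite leNgt; apply/negP => uw; apply: sng.
  apply: Trho.
    rewrite nrm_gt0; apply/eqP => /eqP; rewrite addr_eq0 => /eqP wE.
    by move: uw; rewrite wE nrmN ltxx.
  by rewrite (le_lt_trans (nrmD _ _))//; lra.
rewrite (le_trans (ler_wpM2r (nrm_ge0 x) wu))// nrmV uE mulrC ler_pdivrMr//.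
by rewrite mulrC.
Qed.

(** For every phase [c], the resolvent estimate at [p * c] is applied to the
    vector [y + p^-1 c T* y]. Averaged over the four phases 1, -1, i and -i,
    all cross terms cancel except the one that carries the squared norm of
    [adjoint T y], and what remains is a lower bound of [T] on the range of its
    adjoint. *)
Lemma punctured_range y :
  rho / 4 * nrm (adjoint T y) <= nrm (T (adjoint T y)).
Proof.
have [p pE p0] : exists2 p, p = rho / 4 & 0 < p by exists (rho / 4); rewrite ?divr_gt0.
rewrite -pE; pose u := adjoint T y.
pose al := p%:C%C * inner (T y) y + (p^-1)%:C%C * inner (T u) u.
pose be := inner (T y) u.
pose ga := (p^-1)%:C%C * inner (T y) (T u).
(* With m = p^-1, the phase-free terms give
   m^2 |T u|^2 + |T y|^2 >= 2 |u|^2, and |T y| = |u| since T is normal. *)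
have key c : nrm c = 1 ->
    2 * (nrm u ^+ 2 + complex.Re (Num.conj c * al + Num.conj c ^+ 2 * be)) <=
    nrm (T y) ^+ 2 + p^-1 ^+ 2 * nrm (T u) ^+ 2 + 2 * complex.Re (Num.conj c * ga).
  move=> c1; pose w := p%:C%C * c; pose x := y + ((p^-1)%:C%C * c) *: u.
  have nw : nrm w = p by rewrite nrmM nrm_real c1 mulr1 gtr0_norm.
  have Tx : T x = T y + ((p^-1)%:C%C * c) *: T u by rewrite bopD bopZ.
  have := @punctured_resolvent w _ x; rewrite nw.
  have -> : p < rho / 2 by rewrite pE ltr_pM2l// ltf_pV2 ?posrE// ltr_nat.
  move=> /(_ isT) le1.
  have : (p * nrm x) ^+ 2 <= nrm (spectral_shift T w x) ^+ 2.
    by rewrite ler_sqr ?nnegrE ?nrm_ge0// mulr_ge0 ?nrm_ge0// ltW.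
  rewrite spectral_shiftE nrm2B nrmZ nw innerZr.
  have -> : Num.conj w * inner (T x) x =
      (nrm u ^+ 2)%:C%C + (Num.conj c * al + Num.conj c ^+ 2 * be).
    have PQ : p%:C%C * (p^-1)%:C%C = 1 :> R[i] by rewrite -realCM divff// gt_eqF.
    have kc : c * Num.conj c = 1 by rewrite mulCJ c1 expr1n.
    have uu : inner (T u) y = (nrm u ^+ 2)%:C%C by rewrite adjE innerxx.
    rewrite Tx /x !innerDl !innerDr !innerZl !innerZr uu.
    rewrite /w /al /be [Num.conj (p%:C%C * c)]rmorphM.
    by rewrite [Num.conj (p^-1%:C%C * c)]rmorphM /= !conj_realC phase_expansion.
  have -> : nrm (T x) ^+ 2 = nrm (T y) ^+ 2 + p^-1 ^+ 2 * nrm (T u) ^+ 2 +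
      2 * complex.Re (Num.conj c * ga).
    rewrite Tx nrm2D nrmZ nrmM nrm_real c1 mulr1 exprMn real_normK ?num_real//.
    congr (_ + 2 * complex.Re _).
    by rewrite innerZr rmorphM /= conj_realC /ga mulrA [Num.conj c * _]mulrC.
  rewrite !ReD /=; lra.
have := key 1 (nrm1 R); have := key (- 1) _; rewrite nrmN nrm1 => /(_ erefl).
have := key 'i%C (nrm_i R); have := key (- 'i%C) _; rewrite nrmN nrm_i => /(_ erefl).
have Ty : nrm (T y) = nrm u by rewrite /u (normal_nrmP T).1.
rewrite Ty; clear key; move: al be ga => [a1 a2] [b1 b2] [g1 g2] /= h1 h2 h3 h4.
have : nrm u ^+ 2 <= p^-1 ^+ 2 * nrm (T u) ^+ 2.
  move: h1 h2 h3 h4; lra.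
rewrite -exprMn ler_sqr ?nnegrE ?mulr_ge0 ?nrm_ge0 ?invr_ge0 ?(ltW p0)//.
by rewrite mulrC ler_pdivlMr// mulrC.
Qed.

(** The orthogonal complement of the kernel is the closure of the range of the
    adjoint, to which the estimate of [punctured_range] extends. *)
Lemma punctured_gap x : orth [set y | T y = 0] x -> rho / 4 * nrm x <= nrm (T x).
Proof.
have p0 : 0 < rho / 4 by rewrite divr_gt0.
have TTp : (forall y, closure (range (adjoint T)) y -> rho / 4 * nrm y <= nrm (T y)).
  move=> y /closure_nrm hy; apply/ler_addgt0Pr => e e0.
  pose M := rho / 4 + nrm T.
  have M0 : 0 <= M by rewrite addr_ge0 ?nrm_ge0// ltW.
  have [_ [v _ <-] yv] := hy _ (divS_gt0 e0 M0).
  have := mul_lt_divS e0 M0 yv; rewrite mulrDl => hM.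
  have := punctured_range v; set t := adjoint T v in yv hM *.
  have h1 := nrm_le y t; have h2 := nrm_le (T t) (T y).
  have : nrm (T t - T y) <= nrm T * nrm (y - t).
    by rewrite -bopB (le_trans (nrm_bop _ _))// nrmC.
  have : rho / 4 * nrm y <= rho / 4 * (nrm t + nrm (y - t)) by rewrite ler_pM2l.
  rewrite mulrDr; lra.
move=> xo; apply: TTp.
have sR := closure_range_subspace (adjoint T); set C := closure _ in sR *.
suff -> : x = proj C x by exact: proj_in.
apply/eqP; rewrite -subr_eq0; apply/eqP; apply: inner_self_eq0.
have qo := proj_orth sR x; have pC := proj_in sR x.
rewrite {1}innerBl (inner_eq0C (qo _ pC)) subr0.
apply: xo; rewrite /= -[T]adjK; apply/adj_ker => _ [v _ <-]; apply: qo.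
by apply: subset_closure; exists v.
Qed.
End Punctured.

(** For normal [N], this says that [c] is an isolated point of the spectrum or lies
    outside it. *)
Definition spectrally_isolated N c := exists2 rho : R, 0 < rho &
  forall w, 0 < nrm w -> nrm w < rho -> bounded_below (spectral_shift N (c + w)).

Definition eigenspace N c : set H := [set x | spectral_shift N c x = 0].

Lemma eigenspace_subspace N c : closed_subspace (eigenspace N c).
Proof. exact: ker_subspace. Qed.

Lemma eigenspaceE N c x : eigenspace N c x <-> N x = c *: x.
Proof.
rewrite -[eigenspace _ _ _]/(N x - c *: x = 0); split; first by move/eqP; rewrite subr_eq0 => /eqP.
by move=> ->; rewrite subrr.
Qed.

Lemma normal_adj_eigen N c x : normal_op N -> eigenspace N c x ->
  adjoint N x = Num.conj c *: x.
Proof.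
move=> nN xc; apply/eqP; rewrite -subr_eq0 -spectral_shiftE -adj_shift -nrm_eq0.
by rewrite (normal_nrmP _).1 ?xc ?nrm0//; exact: normal_shift.
Qed.

Lemma spectral_gap N c : normal_op N -> spectrally_isolated N c ->
  exists2 d : R, 0 < d & forall x, orth (eigenspace N c) x -> d * nrm x <= nrm (spectral_shift N c x).
Proof.
move=> nN [rho rho0 h]; exists (rho / 4); first by rewrite divr_gt0.
apply: punctured_gap => //; first exact: normal_shift.
by move=> w w0 wr; rewrite shift_shift; exact: h.
Qed.

Lemma nrm_projC V x : closed_subspace V -> nrm (x - proj V x) <= nrm x.
Proof.
move=> sV; rewrite -ler_sqr ?nnegrE ?nrm_ge0// -[x in leRHS](subrK (proj V x)).
rewrite [leRHS]pythagoras ?lerDl ?sqr_ge0//.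
by apply: (proj_orth sV); exact: (proj_in sV).
Qed.

Lemma proj_commute V f : closed_subspace V ->
  (forall x, V x -> V (f x)) -> (forall x, V x -> V (adjoint f x)) ->
  forall x, proj V (f x) = f (proj V x).
Proof.
move=> sV fV fV' x; apply: (proj_eq sV); first by apply: fV; exact: (proj_in sV).
by move=> y Vy; rewrite -bopB adjE; apply: (proj_orth sV); exact: fV'.
Qed.

(** Let [V] be the orthogonal complement of all eigenvectors with nonzero
    eigenvalue. It reduces [N], and by the spectral gap the compression of [N]
    to [V] is bounded below after subtraction of any nonzero scalar. A nonzero
    normal operator is singular at some nonzero scalar, so this compression
    vanishes. *)
Theorem normal_eigen_complete N : normal_op N -> (forall c, c != 0 -> spectrally_isolated N c) ->
  forall x, (forall c, c != 0 -> orth (eigenspace N c) x) -> N x = 0.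
Proof.
move=> nN iN x0 x0P.
pose V := orth [set y | exists2 c, c != 0 & eigenspace N c y].
have sV : closed_subspace V := orth_subspace _.
have V0 : V x0 by move=> y [c c0 cy]; exact: x0P cy.
have VN y : V y -> V (N y).
  move=> Vy e [c c0 ce]; rewrite adjE (normal_adj_eigen nN ce) innerZr Vy ?mulr0//.
  by exists c.
have VN' y : V y -> V (adjoint N y).
  move=> Vy e [c c0 ce]; rewrite adjE2 ((eigenspaceE _ _ _).1 ce) innerZr Vy ?mulr0//.
  by exists c.
have QN := proj_commute sV VN VN'.
have QN' : forall y, proj V (adjoint N y) = adjoint N (proj V y).
  by apply: proj_commute => // y Vy; rewrite adjK; exact: VN.
(* The compression of N to V is extended by 0 to the whole space. *)
pose M := N * proj V.
have nM : normal_op M.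
  apply/normal_nrmP => y; rewrite /M adjM adj_proj// !bop_mulE QN'.
  exact: (normal_nrmP _).1.
suff M0 : nrm M = 0.
  move/eqP: M0; rewrite nrm_eq0 => /eqP/(congr1 (fun f : bop H => f x0)).
  by rewrite /M bop_mulE proj_id.
apply/eqP; rewrite eq_le nrm_ge0 andbT leNgt; apply/negP => M0.
have [w wM] := normal_peripheral nM M0; apply.
have w0 : w != 0 by rewrite -nrm_gt0 wM.
have nw : 0 < nrm w by rewrite nrm_gt0.
have [d d0 dP] := spectral_gap nN (iN w w0).
exists (d^-1 + (nrm w)^-1)^-1; first by rewrite invr_gt0 addr_gt0// invr_gt0.
move=> x; rewrite mulrC ler_pdivrMr ?addr_gt0 ?invr_gt0//.
set y := spectral_shift M w x.
have Qy : proj V y = spectral_shift N w (proj V x).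
  rewrite /y !spectral_shiftE bopB bopZ /M bop_mulE QN (proj_id sV)//; exact: (proj_in sV).
have Cy : y - proj V y = - w *: (x - proj V x).
  rewrite Qy /y !spectral_shiftE /M bop_mulE opprD addrACA subrr add0r scaleNr scalerBr.
  by rewrite opprB opprK addrC.
have h1 : d * nrm (proj V x) <= nrm y.
  have oQ : orth (eigenspace N w) (proj V x).
    by move=> z wz; have VQ := proj_in sV x; apply: VQ; exists w.
  by rewrite (le_trans (dP _ oQ))// -Qy nrm_proj.
have h2 : nrm w * nrm (x - proj V x) <= nrm y.
  by rewrite -(nrmN w) -nrmZ -Cy nrm_projC.
have := nrm_le x (proj V x); move/le_trans; apply.
rewrite mulrDr lerD//.
  by rewrite ler_pdivlMr// mulrC.
by rewrite ler_pdivlMr// mulrC.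
Qed.
End Gap.

(** * Partial isometries between orthonormal families *)

Section Orthonormal.
Context (R : realType) (H : hilbertType R).
Implicit Types (x y : H) (c d w : R[i]) (T : bop H) (V S : set H).

(** Allowing zero entries lets every separable Hilbert space, whatever its dimension, have a
    basis indexed by [nat]; the pattern of zeros then plays the role of the
    dimension. *)
Definition orthonormal_or_zero (I : Type) (e : I -> H) : Prop :=
  (forall i j, i <> j -> inner (e i) (e j) = 0) /\
  (forall i, e i = 0 \/ nrm (e i) = 1).

Lemma nrm_orthonormal_sum (e : nat -> H) (a : nat -> R[i]) m n :
  orthonormal_or_zero e ->
  nrm (\sum_(m <= k < n) a k *: e k) ^+ 2 <= \sum_(m <= k < n) nrm (a k) ^+ 2.
Proof.
move=> [eo e1]; elim: n => [|n IH]; first by rewrite !big_geq// nrm0 expr0n.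
have [mn|nm] := leqP m n; last by rewrite !big_geq// nrm0 expr0n.
rewrite !big_nat_recr//= pythagoras; last first.
  rewrite inner_suml big_nat big1// => k /andP[_ kn].
  by rewrite innerZl innerZr eo ?mulr0// => kE; rewrite kE ltnn in kn.
rewrite lerD// nrmZ exprMn; case: (e1 n) => ->; first by rewrite nrm0 expr0n mulr0 sqr_ge0.
by rewrite expr1n mulr1.
Qed.

Lemma bessel (e : nat -> H) x n : orthonormal_or_zero e ->
  \sum_(0 <= k < n) nrm (inner x (e k)) ^+ 2 <= nrm x ^+ 2.
Proof.
move=> [eo e1].
suff E : nrm (x - \sum_(0 <= k < n) inner x (e k) *: e k) ^+ 2 =
    nrm x ^+ 2 - \sum_(0 <= k < n) nrm (inner x (e k)) ^+ 2.
  by rewrite -subr_ge0 -E sqr_ge0.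
elim: n => [|n IH]; first by rewrite !big_geq// !subr0.
rewrite !big_nat_recr//= !opprD !addrA -IH.
set r := x - _.
have re : inner r (e n) = inner x (e n).
  rewrite innerBl inner_suml big_nat big1 ?subr0// => k /andP[_ kn].
  by rewrite innerZl eo ?mulr0// => kE; rewrite kE ltnn in kn.
rewrite nrm2B innerZr re [Num.conj _ * _]mulrC mulCJ /= nrmZ exprMn.
case: (e1 n) => en; last by rewrite en; ring.
by rewrite en inner0r !nrm0 expr0n /=; ring.
Qed.

(** Tails of a bounded series of nonnegative terms are small, since a partial sum
    close to the supremum leaves little room. *)
Lemma bounded_series_cauchy (a : nat -> R) (M : R) : (forall n, 0 <= a n) ->
  (forall n, \sum_(0 <= k < n) a k <= M) ->
  forall e : R, 0 < e -> exists N, forall m n, (N <= m)%N -> (m <= n)%N ->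
    \sum_(m <= k < n) a k < e.
Proof.
move=> a0 aM e e0; pose D := range (fun n => \sum_(0 <= k < n) a k).
have sD : has_sup D.
  by split; [exists (\sum_(0 <= k < 0) a k), 0%N | exists M => _ [n _ <-]].
have [_ [N _ <-] hN] := sup_adherent e0 sD.
exists N => m n Nm mn.
have : \sum_(0 <= k < n) a k <= sup D by apply: (sup_upper_bound sD); exists n.
have Nm' : \sum_(0 <= k < N) a k <= \sum_(0 <= k < m) a k.
  by rewrite (big_cat_nat (n := N) (p := m))//= lerDl sumr_ge0.
rewrite (big_cat_nat (n := m) (p := n))//=; move: hN Nm'; lra.
Qed.

(** The image of [x] is the sum of the [inner x (e n) *: f n]; Bessel's inequality
    for [e] controls the tails of this series. *)
Lemma ex_partial_isometry_seq (e f : nat -> H) :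
  orthonormal_or_zero e -> orthonormal_or_zero f -> (forall n, e n = 0 -> f n = 0) ->
  exists V : bop H, (forall n, V (e n) = f n) /\ (forall x, orth (range e) x -> V x = 0).
Proof.
move=> oe off ef.
pose s x n := \sum_(0 <= k < n) inner x (e k) *: f k.
have sE x m n : (m <= n)%N -> s x n - s x m = \sum_(m <= k < n) inner x (e k) *: f k.
  by move=> mn; rewrite /s (big_cat_nat (n := m) (p := n))//= [X in X - _]addrC addrK.
have sx x n : nrm (s x n) <= nrm x.
  rewrite -ler_sqr ?nnegrE ?nrm_ge0//.
  by rewrite (le_trans (nrm_orthonormal_sum _ _ _ off))// bessel.
have /choice[V VP] x : exists l, forall t : R, 0 < t ->
    exists N, forall n, (N <= n)%N -> nrm (s x n - l) < t.
  apply: cauchy_complete => t t0.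
  have t2 : 0 < t ^+ 2 by rewrite exprn_gt0.
  have [||N NP] := @bounded_series_cauchy (fun k => nrm (inner x (e k)) ^+ 2)
      (nrm x ^+ 2) _ _ _ t2.
  - by move=> n; exact: sqr_ge0.
  - by move=> n; exact: bessel.
  have st m n : (N <= m)%N -> (m <= n)%N -> nrm (s x n - s x m) < t.
    move=> Nm mn; rewrite -ltr_sqr ?nnegrE ?nrm_ge0 ?ltW// sE//.
    by rewrite (le_lt_trans (nrm_orthonormal_sum _ _ _ off))// NP.
  exists N => m n Nm Nn; have [mn|/ltnW nm] := leqP m n; last exact: st.
  by rewrite nrmC; exact: st.
have Vlim x l : (forall t : R, 0 < t -> exists N, forall n, (N <= n)%N -> nrm (s x n - l) <= t) ->
    V x = l.
  move=> h; apply/eqP; rewrite -subr_eq0; apply/eqP; apply: nrm_small => t t0.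
  have t2 : 0 < t / 2 by rewrite divr_gt0.
  have [N1 h1] := h _ t2; have [N2 h2] := VP x _ t2.
  rewrite (le_trans (nrm_tri _ (s x (maxn N1 N2)) _))// [leRHS]splitr lerD//.
    by rewrite nrmC ltW// h2// leq_maxr.
  by rewrite h1// leq_maxl.
have [||W WV] := @ex_bop R H V 1.
- move=> c x y; apply: Vlim => t t0.
  have t2 : 0 < t / 2 by rewrite divr_gt0.
  have [N1 h1] := VP x _ (divS_gt0 t2 (nrm_ge0 c)); have [N2 h2] := VP y _ t2.
  exists (maxn N1 N2) => n; rewrite geq_max => /andP[n1 n2].
  have -> : s (c *: x + y) n = c *: s x n + s y n.
    rewrite /s scaler_sumr -big_split /=; apply: eq_bigr => k _.
    by rewrite innerDl innerZl scalerDl scalerA.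
  rewrite opprD addrACA -scalerBr (le_trans (nrmD _ _))// nrmZ [leRHS]splitr.
  by rewrite lerD// ltW ?h2// mul_lt_divS ?nrm_ge0// h1.
- move=> x; rewrite mul1r; apply/ler_addgt0Pr => t /(VP x)[N NP].
  by rewrite (le_trans (nrm_le _ (s x N)))// lerD// nrmC ltW// NP.
exists W; split=> [n|x xe]; rewrite WV; apply: Vlim => t t0.
  exists n.+1 => m nm; suff -> : s (e n) m = f n by rewrite subrr nrm0 ltW.
  rewrite /s (big_cat_nat (n := n) (p := m))//=; last exact: ltnW.
  rewrite big_nat big1 ?add0r; last first.
    by move=> k /andP[_ kn]; rewrite oe.1 ?scale0r// => kE; rewrite kE ltnn in kn.
  rewrite big_ltn// big_nat big1 ?addr0; last first.
    by move=> k /andP[kn _]; rewrite oe.1 ?scale0r// => kE; rewrite kE ltnn in kn.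
  case: (oe.2 n) => en; first by rewrite ef// scaler0.
  by rewrite innerxx en expr1n scale1r.
exists 0%N => m _; rewrite /s big1 ?subrr ?nrm0 ?ltW// => k _.
by rewrite xe ?scale0r//; exists k.
Qed.

Hypothesis sepH : separable H.

(** Two orthogonal unit vectors are at distance the square root of 2, so no
    point of the countable dense set is within one half of both. *)
Lemma orthonormal_code (I : Type) (e : I -> H) : orthonormal_or_zero e ->
  exists code : I -> nat, forall i j, e i <> 0 -> e j <> 0 -> code i = code j -> i = j.
Proof.
move=> [eo e1]; have [D cD dD] := sepH.
have /choice[d dP] i : exists y, D y /\ nrm (e i - y) < 2^-1.
  by have [|y] := dense_nrm dD (e i) (e := 2^-1); [rewrite invr_gt0|exists y].
have /countable_injP[h hinj] := cD.
exists (fun i => h (d i)) => i j ei ej hij.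
apply: contrapT => ij.
have dij : d i = d j by apply: hinj => //; rewrite inE; [case: (dP i)|case: (dP j)].
have E : nrm (e i - e j) ^+ 2 = 1 + 1.
  rewrite nrm2B eo// /= mulr0 subr0.
  by case: (e1 i) => // ->; case: (e1 j) => // ->; rewrite expr1n.
have : nrm (e i - e j) <= 2^-1 + 2^-1.
  rewrite (le_trans (nrm_tri _ (d i) _))// lerD//; first by rewrite ltW// (dP i).2.
  by rewrite dij nrmC ltW// (dP j).2.
have := nrm_ge0 (e i - e j); nra.
Qed.

(** The properties of the adjoint follow from those of the operator by testing
    against [e] and against its orthogonal complement. An arbitrary index type
    permits families labelled by an eigenvalue together with a position in its
    eigenspace. *)
Theorem ex_partial_isometry (I : Type) (e f : I -> H) :
  orthonormal_or_zero e -> orthonormal_or_zero f -> (forall i, e i = 0 <-> f i = 0) ->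
  exists V : bop H, [/\ forall i, V (e i) = f i,
    forall i, adjoint V (f i) = e i,
    forall x, orth (range e) x -> V x = 0 &
    forall x, orth (range f) x -> adjoint V x = 0].
Proof.
move=> oe off ef; have [code codeP] := orthonormal_code oe.
(* A partial inverse of the code, which reindexes both families by nat and
   pads them with zeros. *)
pose ix n : option I := if pselect (exists i, e i <> 0 /\ code i = n) is left h
  then Some (projT1 (cid h)) else None.
have ixP n i : ix n = Some i -> e i <> 0 /\ code i = n.
  rewrite /ix; case: pselect => // h [<-]; exact: (projT2 (cid h)).
have ix_code i : e i <> 0 -> ix (code i) = Some i.
  move=> ei; case E: (ix (code i)) => [j|].
    by have [ej cj] := ixP _ _ E; congr Some; exact: codeP.
  by move: E; rewrite /ix; case: pselect => // -[]; exists i.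
pose seq (g : I -> H) n := if ix n is Some i then g i else 0.
have oseq g : orthonormal_or_zero g -> orthonormal_or_zero (seq g).
  move=> [go g1]; split=> [m n mn|n]; rewrite /seq; last by case: (ix n) => [i|]; [exact: g1|left].
  case Em: (ix m) => [i|]; last by rewrite inner0l.
  case En: (ix n) => [j|]; last by rewrite inner0r.
  apply: go => ij; apply: mn.
  by have [_ <-] := ixP _ _ Em; have [_ <-] := ixP _ _ En; rewrite ij.
have [|V [Ve V0]] := ex_partial_isometry_seq (oseq e oe) (oseq f off).
  by move=> n; rewrite /seq; case: (ix n) => // i /ef.
have {}Ve i : V (e i) = f i.
  have [ei|ei] := pselect (e i = 0); first by rewrite ei bop0 (ef i).1.
  by have := Ve (code i); rewrite /seq ix_code.
have {}V0 x : orth (range e) x -> V x = 0.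
  move=> xe; apply: V0 => _ [n _ <-]; rewrite /seq.
  by case: (ix n) => [i|]; [apply: xe; exists i|rewrite inner0r].
have inj u v : (forall i, inner (e i) (adjoint V v - u) = 0) ->
    (forall x, orth (range e) x -> inner x u = 0) -> adjoint V v = u.
  move=> h1 h2; apply/eqP; rewrite -subr_eq0; apply/eqP.
  set w := _ - _; have we : orth (range e) w.
    by move=> _ [i _ <-]; apply: inner_eq0C; exact: h1.
  by apply: inner_self_eq0; rewrite {2}/w innerBr -adjE V0// inner0l h2// subr0.
exists V; split=> //.
- move=> i; apply: inj => [j|x xe]; last by apply: xe; exists i.
  rewrite innerBr -adjE Ve; have [<-|ij] := pselect (i = j); last first.
    by rewrite oe.1 ?off.1 ?subrr// => ji; apply: ij.
  case: (oe.2 i) => ei; first by rewrite ei (ef i).1// !inner0l subrr.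
  case: (off.2 i) => fi.
    by move: ei; rewrite (ef i).2// nrm0 => /eqP; rewrite eq_sym oner_eq0.
  by rewrite !innerxx ei fi subrr.
- move=> x xf; apply: inj => [j|y _]; last exact: inner0r.
  by rewrite subr0 -adjE Ve; apply: inner_eq0C; apply: xf; exists j.
Qed.
End Orthonormal.

(** * Gram-Schmidt bases of closed subspaces *)

Section GramSchmidt.
Context (R : realType) (H : hilbertType R).
Implicit Types (x y : H) (c : R[i]) (V S A B : set H) (L : bop H) (d e f : nat -> H).

Local Notation proj := (@orthogonal_projection R H).

Definition in_span d n x := exists a : nat -> R[i], x = \sum_(k < n) a k *: d k.

Lemma in_spanP d n c x y : in_span d n x -> in_span d n y -> in_span d n (c *: x + y).
Proof.
move=> [a ->] [b ->]; exists (fun k => c * a k + b k).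
rewrite scaler_sumr -big_split; apply: eq_bigr => k _ /=.
by rewrite scalerDl scalerA.
Qed.

Lemma in_spanS d n x : in_span d n x -> in_span d n.+1 x.
Proof.
move=> [a ->]; exists (fun k => if (k < n)%N then a k else 0).
rewrite big_ord_recr /= ltnn scale0r addr0; apply: eq_bigr => k _.
by rewrite ltn_ord.
Qed.

Lemma in_span_last d n : in_span d n.+1 (d n).
Proof.
exists (fun k => (k == n)%:R); rewrite big_ord_recr /= eqxx scale1r big1 ?add0r//.
by move=> k _; rewrite ltn_eqF// scale0r.
Qed.

Definition initial d n : set H := [set d k | k in [set k | (k < n)%N]].

Lemma orth_span d n x y : orth (initial d n) x -> in_span d n y -> inner y x = 0.
Proof.
move=> xo [a ->]; rewrite inner_suml big1// => k _.
by rewrite innerZl (inner_eq0C (xo _ _)) ?mulr0//; exists k => //=; exact: ltn_ord.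
Qed.

(** Passing from [n] to [n.+1] vectors subtracts from the projection [y] of [x] its
    component along [r], the part of [d n] orthogonal to the earlier vectors. *)
Lemma proj_orth_initial d n x :
  in_span d n (x - proj (orth (initial d n)) x).
Proof.
elim: n x => [|n IH] x.
  exists (fun=> 0); rewrite big_ord0 (proj_id (orth_subspace _)) ?subrr//.
  by move=> u [k].
pose W := orth (initial d n); have sW : closed_subspace W := orth_subspace _.
pose r := proj W (d n); pose y := proj W x.
have Wr : W r := proj_in sW _; have Wy : W y := proj_in sW _.
have [al alP] : exists c, inner (y - c *: r) r = 0.
  have [r0|r0] := eqVneq r 0; first by exists 0; rewrite r0 inner0r.
  exists (inner y r / inner r r); rewrite innerBl innerZl divfK ?subrr//.
  by apply: contra_neq r0 => /inner_self_eq0.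
pose p := y - al *: r; have Wp : W p by apply: (subspaceB sW) => //; exact: (subspaceZ sW).
have sp : in_span d n.+1 (x - p).
  have -> : x - p = al *: (d n) + ((- al) *: (d n - r) + (x - y)).
    rewrite /p opprB addrCA scaleNr scalerBr opprB.
    by rewrite [al *: r - _]addrC -addrA addNKr.
  apply: in_spanP; first exact: in_span_last.
  by apply: in_spanP; apply: in_spanS; exact: IH.
rewrite (proj_eq (orth_subspace _) (p := p))//.
  move=> _ [k /= kn <-]; move: kn; rewrite ltnS leq_eqVlt => /orP[/eqP ->|kn]; last first.
    by apply: Wp; exists k.
  rewrite -[d n](subrK r) innerDr alP addr0.
  by apply: inner_eq0C; apply: (orth_span Wp); exact: IH.
by move=> z zo; exact: orth_span zo sp.
Qed.

(** The vector [e n] is the normalized projection of [d n] on the complement of the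
    earlier vectors; the last clause records where linear dependence creates a
    zero entry. *)
Theorem gram_schmidt d : exists e, [/\ orthonormal_or_zero e,
  forall V, closed_subspace V -> (forall n, V (d n)) -> forall n, V (e n),
  forall x, orth (range e) x -> orth (range d) x &
  forall n, e n = 0 <-> in_span d n (d n)].
Proof.
pose W n := orth (initial d n).
have sW n : closed_subspace (W n) := orth_subspace _.
pose r n := proj (W n) (d n); pose e n := (nrm (r n))^-1%:C%C *: r n.
have Wr n : W n (r n) := proj_in (sW n) _.
have We n : W n (e n) by exact: (subspaceZ (sW n)).
have rE n : r n = (nrm (r n))%:C%C *: e n.
  have [r0|r0] := eqVneq (r n) 0; first by rewrite /e r0 !scaler0.
  by rewrite /e scalerA -realCM divff ?nrm_eq0// scale1r.
have dr n x : W n x -> inner (d n - r n) x = 0.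
  by move=> Wx; apply: (orth_span Wx); exact: proj_orth_initial.
have eo m n : (m < n)%N -> inner (e m) (e n) = 0.
  move=> mn; rewrite {1}/e innerZl.
  have -> : r m = d m - (d m - r m) by rewrite subKr.
  rewrite innerBl dr; last first.
    by move=> _ [k km <-]; apply: We; exists k => //; exact: ltn_trans mn.
  rewrite (inner_eq0C (We n _ _)) ?subrr ?mulr0//.
  by exists m.
exists e; split.
- split=> [m n mn|n].
    have [mn'|nm|//] := ltngtP m n; first exact: eo.
    by apply: inner_eq0C; exact: eo.
  have [r0|r0] := eqVneq (r n) 0; first by left; rewrite /e r0 scaler0.
  right; rewrite /e nrmZ nrm_real ger0_norm ?invr_ge0 ?nrm_ge0//.
  by rewrite mulVf// nrm_eq0.
- move=> V sV Vd n; apply: (subspaceZ sV).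
  rewrite -[r n](subKr (d n)); apply: (subspaceB sV) => //.
  apply: (orth_orth sV) => x xV; apply: dr => _ [k _ <-]; exact: xV.
- move=> x xe _ [n _ <-]; elim/ltn_ind: n => n IH.
  have Wx : W n x by move=> _ [k kn <-]; exact: IH.
  rewrite -[d n](subrK (r n)) innerDr (inner_eq0C (dr _ _ Wx)) add0r.
  by rewrite rE innerZr xe ?mulr0//; exists n.
- move=> n; have sp := proj_orth_initial d n (d n); rewrite -/(W n) -/(r n) in sp.
  split=> [en|spd]; first by move: sp; rewrite rE en scaler0 subr0.
  have : in_span d n (r n).
    by rewrite -[r n](subKr (d n)) addrC -scaleN1r; exact: in_spanP.
  by move=> /(orth_span (Wr n))/inner_self_eq0 r0; rewrite /e r0 scaler0.
Qed.

Hypothesis sepH : separable H.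

Lemma dense_sequence : exists d, forall x (t : R), 0 < t -> exists n, nrm (x - d n) < t.
Proof.
have [D /countable_injP[h hinj] dD] := sepH.
have /choice[d dP] n : exists y, forall z, D z -> h z = n -> y = z.
  have [[z [Dz zn]]|nz] := pselect (exists z, D z /\ h z = n).
    by exists z => y Dy yn; apply: hinj; rewrite ?inE// zn yn.
  by exists 0 => z Dz zn; case: nz; exists z.
exists d => x t t0; have [y Dy xy] := dense_nrm dD x t0.
by exists (h y); rewrite (dP _ _ Dy erefl).
Qed.

(** Gram-Schmidt applied to the projections of a dense sequence. *)
Theorem ex_basis V : closed_subspace V -> exists e, [/\ orthonormal_or_zero e,
  forall n, V (e n) & forall x, V x -> orth (range e) x -> x = 0].
Proof.
move=> sV; have [d dP] := dense_sequence.
have [e [eo eV ed _]] := gram_schmidt (fun n => proj V (d n)).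
exists e; split=> //; first by apply: eV => // n; exact: (proj_in sV).
move=> x Vx /ed xd; apply/eqP; rewrite -nrm_eq0 eq_le nrm_ge0 andbT leNgt.
apply/negP => x0; have [n xn] := dP x _ x0.
have xdn : inner x (d n) = 0.
  by rewrite -{1}(proj_id sV Vx) proj_adj// xd//; exists n.
have : nrm x ^+ 2 <= nrm x * nrm (x - d n).
  rewrite nrm2E (_ : inner x x = inner x (x - d n)) ?innerBr ?xdn ?subr0//.
  by rewrite (le_trans (Re_le_nrm _))// -[inner x x]subr0 -xdn -innerBr cauchy_schwarz.
by rewrite expr2 ler_pM2l// leNgt xn.
Qed.

(** Equality of Hilbert dimensions in the form needed later. An injective operator
    from [A] to a dense part of [B] preserves linear independence of initial
    segments, so Gram-Schmidt produces in [B] a basis with the same zero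
    entries. *)
Theorem transport_basis A B L e : closed_subspace A -> closed_subspace B ->
  (forall x, A x -> B (L x)) -> (forall x, A x -> L x = 0 -> x = 0) ->
  (forall y, B y -> (forall x, A x -> inner y (L x) = 0) -> y = 0) ->
  orthonormal_or_zero e -> (forall n, A (e n)) ->
  (forall x, A x -> orth (range e) x -> x = 0) ->
  exists f, [/\ orthonormal_or_zero f, forall n, B (f n),
    forall x, B x -> orth (range f) x -> x = 0 & forall n, e n = 0 <-> f n = 0].
Proof.
move=> sA sB LAB Linj Ldense eo eA ec.
have [f [fo fV fd fs]] := gram_schmidt (fun n => L (e n)).
exists f; split=> //.
- by apply: fV => // n; exact: LAB.
- move=> y By /fd yL; apply: Ldense => // x Ax.
  have h : orth (range e) (proj A (adjoint L y)).
    by move=> _ [n _ <-]; rewrite proj_adj// proj_id// adjE2 yL//; exists n.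
  have h0 := ec _ (proj_in sA _) h.
  by rewrite -adjE2 -[x](proj_id sA)// -proj_adj// h0 inner0l.
- move=> n; split=> [en|/fs[a aE]].
    apply/fs; exists (fun=> 0); rewrite en bop0 big1// => k _; exact: scale0r.
  have enE : e n = \sum_(k < n) a k *: e k.
    apply/eqP; rewrite -subr_eq0; apply/eqP; apply: Linj.
      apply: (subspaceB sA) => //; elim/big_ind: _ => [|x y|k _].
      - exact: (subspace0 sA).
      - exact: (subspaceD sA).
      - exact: (subspaceZ sA).
    rewrite bopB linear_sum aE -sumrB big1// => k _.
    by rewrite linearZ subrr.
  apply: inner_self_eq0; rewrite {1}enE inner_suml big1// => k _.
  rewrite innerZl eo.1 ?mulr0// => kn; have := ltn_ord k.
  by rewrite kn ltnn.
Qed.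
End GramSchmidt.

(** * Norm limits of groupoid orbits *)

Section Orbit.
Context (R : realType) (H : hilbertType R).
Implicit Types (x y : H) (c w : R[i]) (a b v : bop H) (S V : set H).

Local Notation proj := (@orthogonal_projection R H).

Lemma orth_closure S x : orth S x -> orth (closure S) x.
Proof.
move=> xS y Sy; apply: inner_eq0C.
have [_ _ cl] := orth_subspace [set x].
have : orth [set x] y; last by apply.
apply: cl; apply: closure_subset Sy => z Sz _ ->.
exact: inner_eq0C (xS z Sz).
Qed.

Section Support.
Variables (a : bop H) (na : normal_op a).
Let p := range_projection a.
Let sR := closure_range_subspace a.

Lemma range_projection_id x : closure (range a) x -> p x = x.
Proof. exact: (proj_id sR). Qed.

Lemma range_projection_mul x : p (a x) = a x.
Proof. by apply: range_projection_id; apply: subset_closure; exists x. Qed.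

Lemma range_projection_ker x : a x = 0 -> p x = 0.
Proof.
move=> ax; apply: (proj_eq0 sR); apply: orth_closure; apply/adj_ker.
by apply/eqP; rewrite -nrm_eq0 (normal_nrmP _).1// ax nrm0.
Qed.

Lemma mul_range_projection x : a (p x) = a x.
Proof.
apply/eqP; rewrite -subr_eq0 -bopB -nrm_eq0 -(normal_nrmP _).1//.
have -> : adjoint a (p x - x) = 0.
  apply/adj_ker => y ay; rewrite -opprB innerNl (proj_orth sR) ?oppr0//.
  exact: subset_closure.
by rewrite nrm0.
Qed.

Lemma range_projection_adj : adjoint p = p.
Proof. exact: adj_proj sR. Qed.

Lemma range_projection_mul_adj x : p (adjoint a x) = adjoint a x.
Proof.
apply: inner_inj => y; rewrite -range_projection_adj -adjE -!adjE.
by rewrite mul_range_projection.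
Qed.

Lemma range_projection_eigen c x : c != 0 -> eigenspace a c x -> p x = x.
Proof.
move=> c0 /eigenspaceE ax; have -> : x = a (c^-1 *: x).
  by rewrite bopZ ax scalerA mulVf// scale1r.
exact: range_projection_mul.
Qed.

Section Conjugate.
Variables (v : bop H) (vp : adjoint v * v = p).
Let b := v * a * adjoint v.

Lemma orbit_nrm x : nrm (v x) = nrm (p x).
Proof.
apply/eqP; rewrite -(eqrXn2 (n := 2)) ?nrm_ge0// !nrm2E adjE -bop_mulE vp.
by rewrite [X in _ == complex.Re X]adjE range_projection_adj [p (p _)]range_projection_id//; exact: (proj_in sR).
Qed.

Lemma orbit_nrm_le x : nrm (v x) <= nrm x.
Proof. by rewrite orbit_nrm nrm_proj. Qed.

Lemma orbit_adj_nrm_le x : nrm (adjoint v x) <= nrm x.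
Proof.
have n1 : nrm (adjoint v) <= 1.
  by rewrite nrm_adj; apply: nrm_bop_le => // y; rewrite mul1r orbit_nrm_le.
by rewrite (le_trans (nrm_bop _ _))// ler_piMl ?nrm_ge0.
Qed.

(** On the initial space of [v] the conjugated operator is [a] itself, which turns
    lower bounds for [a] into lower bounds for its conjugates. *)
Lemma orbit_intertwine x : adjoint v (b x) = a (adjoint v x).
Proof. by rewrite /b !bop_mulE -(bop_mulE _ v) vp range_projection_mul. Qed.

Lemma orbit_mul x : b (v x) = v (a x).
Proof. by rewrite /b !bop_mulE -(bop_mulE _ v) vp mul_range_projection. Qed.

Lemma orbit_adj : adjoint b = v * adjoint a * adjoint v.
Proof. by rewrite /b !adjM adjK mulrA. Qed.

Lemma orbit_normal : normal_op b.
Proof.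
apply/normal_nrmP => x; rewrite orbit_adj /b !bop_mulE !orbit_nrm.
by rewrite range_projection_mul_adj range_projection_mul (normal_nrmP _).1.
Qed.

Lemma orbit_shift_adj c x :
  nrm (spectral_shift a c (adjoint v x)) <= nrm (spectral_shift b c x).
Proof.
by rewrite !spectral_shiftE -bopZ -orbit_intertwine -bopB orbit_adj_nrm_le.
Qed.

Lemma orbit_nrm_mul x : nrm (b x) <= nrm a * nrm (adjoint v x).
Proof. by rewrite /b !bop_mulE (le_trans (orbit_nrm_le _))// nrm_bop. Qed.

(** The bound depends on [a] but not on [v], and so survives norm limits. Off the
    final space of [v] the conjugate of [a] vanishes, whence the restriction to
    nonzero [w]. *)
Lemma orbit_bounded_below (d : R) w x : 0 < d -> w != 0 ->
  (forall y, d * nrm y <= nrm (spectral_shift a w y)) ->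
  nrm w / (1 + nrm a / d) * nrm x <= nrm (spectral_shift b w x).
Proof.
move=> d0 w0 ad; have D : 0 < 1 + nrm a / d.
  by rewrite ltr_pwDl// divr_ge0 ?nrm_ge0// ltW.
rewrite mulrAC ler_pdivrMr// -nrmZ.
have h1 : d * nrm (adjoint v x) <= nrm (spectral_shift b w x).
  by rewrite (le_trans (ad _))// orbit_shift_adj.
rewrite (le_trans (nrm_le _ (b x)))// nrmC -[b x - _]spectral_shiftE mulrDr mulr1 addrC lerD//.
rewrite (le_trans (orbit_nrm_mul x))// mulrCA ler_wpM2l ?nrm_ge0//.
by rewrite ler_pdivlMr// mulrC.
Qed.
End Conjugate.
End Support.

Lemma eigenspace_orth a c w x y : normal_op a -> c <> w ->
  eigenspace a c x -> eigenspace a w y -> inner x y = 0.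
Proof.
move=> na cw /eigenspaceE ax wy.
have : c * inner x y = w * inner x y.
  by rewrite -innerZl -ax adjE (normal_adj_eigen na wy) innerZr conjCK.
by move/eqP; rewrite -subr_eq0 -mulrBl mulf_eq0 subr_eq0 => /orP[/eqP//|/eqP].
Qed.

Section Limit.
Variables (a b : bop H) (na : normal_op a).
Hypothesis ab : forall t : R, 0 < t -> exists v,
  adjoint v * v = range_projection a /\ nrm (b - v * a * adjoint v) < t.

Lemma orbit_limit_normal : normal_op b.
Proof.
apply/normal_nrmP => x; apply/eqP; rewrite -subr_eq0 -normr_le0.
apply/ler_addgt0Pr => t t0; rewrite add0r.
have t2 : 0 < t / 2 by rewrite divr_gt0.
have [v [vp bv]] := ab (divS_gt0 t2 (nrm_ge0 x)).
set b' := v * a * adjoint v in bv.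
have nb' : nrm (adjoint b' x) = nrm (b' x) by apply: (normal_nrmP _).1; exact: orbit_normal.
have h1 : nrm (b x - b' x) <= t / 2.
  by rewrite -bop_subE (le_trans (nrm_bop _ _))// mulrC ltW// mul_lt_divS// nrm_ge0.
have h2 : nrm (adjoint b x - adjoint b' x) <= t / 2.
  rewrite -bop_subE -adjB (le_trans (nrm_bop _ _))// nrm_adj mulrC ltW//.
  by rewrite mul_lt_divS// nrm_ge0.
have k1 := nrm_le (b x) (b' x); have k2 := nrm_le (b' x) (b x).
have k3 := nrm_le (adjoint b x) (adjoint b' x).
have k4 := nrm_le (adjoint b' x) (adjoint b x).
rewrite [nrm (b' x - _)]nrmC in k2; rewrite [nrm (adjoint b' x - _)]nrmC nb' in k4.
by rewrite nb' in k3; rewrite ler_norml; apply/andP; split; lra.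
Qed.

Lemma orbit_limit_isolated c : c != 0 -> spectrally_isolated a c -> spectrally_isolated b c.
Proof.
move=> c0 [rho rho0 h]; exists (Num.min rho (nrm c)).
  by rewrite lt_min rho0 nrm_gt0.
move=> w w0; rewrite lt_min => /andP[wr wc].
have cw0 : c + w != 0.
  by apply: contraTneq wc => /eqP; rewrite addr_eq0 => /eqP ->; rewrite nrmN ltxx.
have [d d0 dP] := h w w0 wr.
pose k := nrm (c + w) / (1 + nrm a / d).
have k0 : 0 < k.
  by rewrite divr_gt0 ?nrm_gt0// ltr_pwDl// divr_ge0 ?nrm_ge0// ltW.
have k2 : 0 < k / 2 by rewrite divr_gt0.
have [v [vp bv]] := ab k2; exists (k / 2) => // x.
have := orbit_bounded_below vp x d0 cw0 dP; rewrite -/k.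
set b' := v * a * adjoint v in bv * => h1.
have : nrm (spectral_shift b' (c + w) x - spectral_shift b (c + w) x) <= k / 2 * nrm x.
  rewrite !spectral_shiftE opprB addrA subrK -bop_subE (le_trans (nrm_bop _ _))//.
  by rewrite nrmC ler_wpM2r ?nrm_ge0// ltW.
have := nrm_le (spectral_shift b' (c + w) x) (spectral_shift b (c + w) x); lra.
Qed.

Hypothesis sepH : separable H.

(** Eigenspaces do not change dimension in a norm limit. Both [a] and [b] have a
    gap at [c]; when [v a v*] is closer to [b] than these gaps allow, moving
    an eigenvector of [a] by [v] and projecting it on the eigenspace of [b] is
    injective with dense range. *)
Lemma orbit_limit_bases c : c != 0 -> spectrally_isolated a c ->
  exists ef : (nat -> H) * (nat -> H), let: (e, f) := ef in
  [/\ orthonormal_or_zero e /\ orthonormal_or_zero f,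
    (forall n, eigenspace a c (e n)) /\ (forall n, eigenspace b c (f n)),
    forall x, eigenspace a c x -> orth (range e) x -> x = 0,
    forall x, eigenspace b c x -> orth (range f) x -> x = 0 &
    forall n, e n = 0 <-> f n = 0].
Proof.
move=> c0 ia.
have [da da0 aP] := spectral_gap na ia.
have [db db0 bP] := spectral_gap orbit_limit_normal (orbit_limit_isolated c0 ia).
have D : 0 < 1 + nrm a / da by rewrite ltr_pwDl// divr_ge0 ?nrm_ge0// ltW.
pose k := nrm c / (1 + nrm a / da).
have k0 : 0 < k by rewrite divr_gt0 ?nrm_gt0.
(* Closeness below db gives injectivity, closeness below k dense range. *)
have m0 : 0 < Num.min db k by rewrite lt_min db0.
have [v [vp]] := ab m0; rewrite lt_min => /andP[bvd bvk].
set b' := v * a * adjoint v in bvd bvk.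
have sA := eigenspace_subspace a c; have sB := eigenspace_subspace b c.
have small (s : R) x : s * nrm x <= nrm (b - b') * nrm x -> nrm (b - b') < s -> x = 0.
  move=> h hs; apply/eqP; rewrite -nrm_eq0 eq_le nrm_ge0 andbT leNgt.
  by apply/negP => x0; move: h; rewrite ler_pM2r// leNgt hs.
have [e [eo eA ec]] := ex_basis sepH sA.
have [|||f [fo fB fc ef]] := @transport_basis R H (eigenspace a c) (eigenspace b c)
   (proj (eigenspace b c) * v) e sA sB _ _ _ eo eA ec.
- by move=> x _; rewrite bop_mulE; exact: (proj_in sB).
- move=> x Ax; rewrite bop_mulE => vx0.
  have vx : nrm (v x) = nrm x.
    by rewrite (orbit_nrm vp) (range_projection_eigen c0 Ax).
  apply/eqP; rewrite -nrm_eq0 -vx nrm_eq0; apply/eqP; apply: (small db) => //.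
  have o : orth (eigenspace b c) (v x).
    by rewrite -[v x]subr0 -vx0; exact: (proj_orth sB).
  rewrite (le_trans (bP _ o))// (le_trans _ (nrm_bop _ _))//.
  rewrite bop_subE [b' _](orbit_mul na vp) ((eigenspaceE _ _ _).1 Ax) bopZ.
  by rewrite spectral_shiftE.
- move=> y By yL.
  have o : orth (eigenspace a c) (adjoint v y).
    move=> x Ax; rewrite adjE2 -[RHS](yL x Ax) bop_mulE -(proj_adj sB).
    by rewrite (proj_id sB).
  have by' : b y = c *: y by exact/eigenspaceE.
  have bb : nrm (b' y - c *: y) <= nrm (b - b') * nrm y.
    by rewrite -by' nrmC -bop_subE nrm_bop.
  have h1 : da * nrm (adjoint v y) <= nrm (b - b') * nrm y.
    by rewrite (le_trans (aP _ o))// (le_trans (orbit_shift_adj vp c y)).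
  apply: (small k) => //; rewrite /k mulrAC ler_pdivrMr// -nrmZ.
  rewrite (le_trans (nrm_le _ (b' y)))// nrmC mulrDr mulr1 addrC lerD//.
  rewrite (le_trans (orbit_nrm_mul vp y))// mulrCA ler_wpM2l ?nrm_ge0//.
  by rewrite ler_pdivlMr// mulrC.
by exists (e, f); split.
Qed.

Lemma basis_orth V (e : nat -> H) x : closed_subspace V -> (forall n, V (e n)) ->
  (forall y, V y -> orth (range e) y -> y = 0) -> orth (range e) x -> orth V x.
Proof.
move=> sV Ve eV xe; suff h : proj V x = 0.
  by rewrite -[x]subr0 -h; exact: (proj_orth sV).
apply: eV; first exact: (proj_in sV).
move=> _ [n _ <-]; rewrite proj_adj// proj_id//; apply: xe; by exists n.
Qed.

(** Matching bases of all nonzero eigenspaces define the partial isometry that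
    carries [a] to [b]; completeness of the eigenvectors of [a] and of [b]
    handles the orthogonal complements, where both operators vanish. *)
Theorem orbit_limit_in_orbit : (forall c, c != 0 -> spectrally_isolated a c) ->
  groupoid_orbit a b.
Proof.
move=> ia; have nb := orbit_limit_normal.
have ib c : c != 0 -> spectrally_isolated b c.
  by move=> c0; apply: orbit_limit_isolated => //; exact: ia.
have /choice[EF EFP] c : exists ef : (nat -> H) * (nat -> H), c != 0 ->
  [/\ orthonormal_or_zero ef.1 /\ orthonormal_or_zero ef.2,
    (forall n, eigenspace a c (ef.1 n)) /\ (forall n, eigenspace b c (ef.2 n)),
    forall x, eigenspace a c x -> orth (range ef.1) x -> x = 0,
    forall x, eigenspace b c x -> orth (range ef.2) x -> x = 0 &
    forall n, ef.1 n = 0 <-> ef.2 n = 0].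
  have [->|c0] := eqVneq c 0; first by exists (fun=> 0, fun=> 0).
  by have [[e f] efP] := orbit_limit_bases c0 (ia c c0); exists (e, f).
(* Only nonzero eigenvalues contribute, since v vanishes on the kernel of a. *)
pose e (i : R[i] * nat) : H := if i.1 == 0 then 0 else (EF i.1).1 i.2.
pose f (i : R[i] * nat) : H := if i.1 == 0 then 0 else (EF i.1).2 i.2.
have eA i : eigenspace a i.1 (e i).
  rewrite /e; case: eqVneq => [_|i0]; first exact: subspace0 (eigenspace_subspace _ _).
  by have [_ [h _] _ _ _] := EFP _ i0; exact: h.
have fB i : eigenspace b i.1 (f i).
  rewrite /f; case: eqVneq => [_|i0]; first exact: subspace0 (eigenspace_subspace _ _).
  by have [_ [_ h] _ _ _] := EFP _ i0; exact: h.
have eo : orthonormal_or_zero e.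
  split=> [[c m] [d n] ij|[c n]]; last first.
    rewrite /e /=; case: eqVneq => [_|c0]; first by left.
    by have [[[_ h] _] _ _ _ _] := EFP _ c0.
  have [cd|cd] := pselect (c = d); last exact: eigenspace_orth na cd (eA (c, m)) (eA (d, n)).
  move: ij; rewrite -cd /e /= => ij; case: eqVneq => [_|c0]; first exact: inner0l.
  by have [[[h _] _] _ _ _ _] := EFP _ c0; apply: h => mn; apply: ij; rewrite mn.
have fo : orthonormal_or_zero f.
  split=> [[c m] [d n] ij|[c n]]; last first.
    rewrite /f /=; case: eqVneq => [_|c0]; first by left.
    by have [[_ [_ h]] _ _ _ _] := EFP _ c0.
  have [cd|cd] := pselect (c = d); last exact: eigenspace_orth nb cd (fB (c, m)) (fB (d, n)).
  move: ij; rewrite -cd /f /= => ij; case: eqVneq => [_|c0]; first exact: inner0l.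
  by have [[_ [h _]] _ _ _ _] := EFP _ c0; apply: h => mn; apply: ij; rewrite mn.
have ef i : e i = 0 <-> f i = 0.
  rewrite /e /f; case: eqVneq => // i0.
  by have [_ _ _ _ h] := EFP _ i0; exact: h.
have [V [Ve Vf V0 V'0]] := ex_partial_isometry sepH eo fo ef.
have e_ker x : orth (range e) x -> a x = 0.
  move=> xe; apply: (normal_eigen_complete na ia) => c c0.
  have [_ [h _] k _ _] := EFP _ c0.
  apply: (basis_orth (eigenspace_subspace a c) h k) => _ [n _ <-]; apply: xe.
  by exists (c, n) => //; rewrite /e /= (negbTE c0).
have f_ker x : orth (range f) x -> b x = 0.
  move=> xf; apply: (normal_eigen_complete nb ib) => c c0.
  have [_ [_ h] _ k _] := EFP _ c0.
  apply: (basis_orth (eigenspace_subspace b c) h k) => _ [n _ <-]; apply: xf.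
  by exists (c, n) => //; rewrite /f /= (negbTE c0).
exists V.
  apply: (bop_eq_orth (S := range e)) => [_ [i _ <-]|x xe].
    rewrite bop_mulE Ve Vf; have [i0|i0] := eqVneq i.1 0.
      by rewrite /e i0 eqxx bop0.
    by rewrite (range_projection_eigen i0 (eA i)).
  by rewrite bop_mulE V0// bop0 (range_projection_ker na)// e_ker.
apply: (bop_eq_orth (S := range f)) => [_ [i _ <-]|x xf].
  rewrite !bop_mulE Vf ((eigenspaceE _ _ _).1 (eA i)) bopZ Ve.
  by rewrite ((eigenspaceE _ _ _).1 (fB i)).
by rewrite !bop_mulE V'0// !bop0 f_ker.
Qed.
End Limit.
End Orbit.

(** * Orthonormal approximate eigenvectors at a limit point *)

Section ApproximateEigenvectors.
Context (R : realType) (H : hilbertType R).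
Implicit Types (x y : H) (c w : R[i]) (a b T : bop H) (S V : set H) (d : nat -> H).

Local Notation proj := (@orthogonal_projection R H).

Lemma bop_sum T (I : Type) (r : seq I) (P : pred I) (F : I -> H) :
  T (\sum_(i <- r | P i) F i) = \sum_(i <- r | P i) T (F i).
Proof. exact: linear_sum. Qed.

(** The image of the hyperplane is closed, so the image of a vector outside the
    hyperplane keeps a nonzero component [r] orthogonal to it, by
    injectivity. *)
Lemma bounded_below_hyperplane T V y (c : R) : closed_subspace V ->
  (forall x, V x -> T x = 0 -> x = 0) -> 0 < c ->
  (forall x, V x -> inner x y = 0 -> c * nrm x <= nrm (T x)) ->
  exists2 d : R, 0 < d & forall x, V x -> d * nrm x <= nrm (T x).
Proof.
move=> sV inj c0 cT.
have [Vy|/existsNP[u0 /not_implyP[Vu0 /eqP uy]]] := pselect (forall x, V x -> inner x y = 0).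
  by exists c => // x Vx; apply: cT => //; exact: Vy.
pose W := V `&` orth [set y]; have sW := subspaceI sV (orth_subspace [set y]).
have sTW := closed_image sW c0 (f := T) (fun x xW => cT x xW.1 (xW.2 y erefl)).
pose u := (inner u0 y)^-1 *: u0.
have Vu : V u by exact: (subspaceZ sV).
have u1 : inner u y = 1 by rewrite innerZl mulVf.
have [w0 [Vw0 w0y] w0E] := proj_in sTW (T u).
pose r := T (u - w0).
have rE : r = T u - proj (T @` W) (T u) by rewrite /r bopB w0E.
have ro : orth (T @` W) r by rewrite rE; exact: (proj_orth sTW).
have k1 : inner (u - w0) y = 1 by rewrite innerBl u1 w0y// subr0.
have r0 : 0 < nrm r.
  rewrite nrm_gt0; apply/eqP => /inj h; move: k1; rewrite h ?inner0l.
    by move/eqP; rewrite eq_sym oner_eq0.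
  exact: (subspaceB sV).
exists (nrm (u - w0) / nrm r + c^-1)^-1.
  by rewrite invr_gt0 ltr_wpDl ?divr_ge0 ?nrm_ge0// invr_gt0.
move=> x Vx; rewrite mulrC ler_pdivrMr; last first.
  by rewrite ltr_wpDl ?divr_ge0 ?nrm_ge0// invr_gt0.
pose al := inner x y; pose x' := x - al *: (u - w0).
have Wx' : W x'.
  split; first by apply: (subspaceB sV) => //; apply: (subspaceZ sV); exact: (subspaceB sV).
  by move=> _ ->; rewrite innerBl innerZl k1 mulr1 subrr.
have TxE : T x = al *: r + T x' by rewrite /x' bopB bopZ addrC subrK.
have pyt : nrm (T x) ^+ 2 = nrm (al *: r) ^+ 2 + nrm (T x') ^+ 2.
  by rewrite TxE pythagoras// innerZl ro ?mulr0//; exists x'.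
have h1 : nrm (al *: r) <= nrm (T x).
  by rewrite -ler_sqr ?nnegrE ?nrm_ge0// pyt lerDl sqr_ge0.
have h2 : nrm (T x') <= nrm (T x).
  by rewrite -ler_sqr ?nnegrE ?nrm_ge0// pyt lerDr sqr_ge0.
have xE : x = al *: (u - w0) + x' by rewrite /x' addrC subrK.
rewrite {1}xE (le_trans (nrmD _ _))// mulrDr lerD//.
  rewrite nrmZ mulrA ler_pdivlMr// mulrAC -nrmZ.
  by rewrite ler_wpM2r ?nrm_ge0.
rewrite ler_pdivlMr// mulrC (le_trans (cT _ Wx'.1 (Wx'.2 y erefl)))//.
Qed.

Lemma bounded_below_codim T V d n (c : R) : closed_subspace V ->
  (forall x, V x -> T x = 0 -> x = 0) -> 0 < c ->
  (forall x, V x -> orth (initial d n) x -> c * nrm x <= nrm (T x)) ->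
  exists2 e : R, 0 < e & forall x, V x -> e * nrm x <= nrm (T x).
Proof.
move=> sV inj; elim: n c => [|n IH] c c0 cT.
  by exists c => // x Vx; apply: cT => // u [].
have sW := subspaceI sV (orth_subspace (initial d n)).
have [|x [Vx xo] xd|e e0 eT] := bounded_below_hyperplane (T := T) (y := d n) sW _ c0 _.
- by move=> x [Vx _]; exact: inj.
- apply: cT => // _ [k /= kn <-]; move: kn.
  by rewrite ltnS leq_eqVlt => /orP[/eqP -> //|kn]; apply: xo; exists k.
- by apply: (IH e e0) => x Vx xo; apply: eT.
Qed.

Section LimitPoint.
Variables (a : bop H) (na : normal_op a) (z : R[i]).
Hypothesis zlim : limit_point (spectrum a) z.
Let T := spectral_shift a z.
Let Z := eigenspace a z.
Let sZ : closed_subspace Z := eigenspace_subspace a z.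
Let nT : normal_op T := normal_shift z na.

(** Otherwise the kernel splits off and [a] is bounded below after subtraction of
    any scalar close to [z] but different from it. *)
Lemma not_bounded_below_off_kernel :
  ~ exists2 c : R, 0 < c & forall x, orth Z x -> c * nrm x <= nrm (T x).
Proof.
move=> [c c0 cT].
have [y [yz ya zy]] := (limit_point_nrm _ _).1 zlim c c0.
have /(spectrumP _ na) := ya; apply.
pose w := y - z; have w0 : 0 < nrm w by rewrite nrm_gt0 subr_eq0.
have wc : 0 < c - nrm w by rewrite subr_gt0 /w nrmC.
have Tz x : Z x -> T x = 0 by [].
have ZT x : Z x -> Z (T x) by move=> /Tz ->; exact: (subspace0 sZ).
have ZT' x : Z x -> Z (adjoint T x).
  move=> Zx; have -> : adjoint T x = 0; last exact: (subspace0 sZ).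
  by apply/eqP; rewrite -nrm_eq0 (normal_nrmP T).1// [T _]Zx nrm0.
have PT := proj_commute sZ ZT ZT'.
exists ((nrm w)^-1 + (c - nrm w)^-1)^-1; first by rewrite invr_gt0 addr_gt0 ?invr_gt0.
move=> x; rewrite mulrC ler_pdivrMr ?addr_gt0 ?invr_gt0//.
have -> : spectral_shift a y = spectral_shift T w by rewrite /T shift_shift /w addrC subrK.
set t := spectral_shift T w x.
have Pt : proj Z t = - w *: proj Z x.
  rewrite /t spectral_shiftE bopB bopZ PT scaleNr.
  by rewrite Tz ?sub0r//; exact: (proj_in sZ).
have Ct : t - proj Z t = spectral_shift T w (x - proj Z x).
  rewrite Pt /t !(spectral_shiftE T w) bopB scalerBr.
  rewrite (Tz _ (proj_in sZ x)) subr0.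
  by rewrite scaleNr opprK opprB -addrA [- _ + _]addrC.
have h1 : nrm w * nrm (proj Z x) <= nrm t.
  by rewrite -(nrmN w) -nrmZ -Pt nrm_proj.
have h2 : (c - nrm w) * nrm (x - proj Z x) <= nrm t.
  apply: le_trans (nrm_projC t sZ); rewrite Ct spectral_shiftE mulrBl lerBlDr.
  have := cT _ (proj_orth sZ x); move/le_trans; apply.
  rewrite (le_trans (nrm_le _ (T (x - proj Z x) - w *: (x - proj Z x))))// lerD2l.
  by rewrite subKr nrmZ.
have := nrm_le x (proj Z x); move/le_trans; apply.
by rewrite mulrDr lerD// ler_pdivlMr// mulrC.
Qed.

Lemma ex_approximate_eigenvector d n (t : R) : 0 < t ->
  exists x, [/\ orth Z x, orth (initial d n) x, nrm x = 1 & nrm (T x) <= t].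
Proof.
move=> t0; apply: contrapT => h; apply: not_bounded_below_off_kernel.
apply: (@bounded_below_codim T (orth Z) d n t (orth_subspace Z)) => //.
  by move=> x xZ Tx; exact: (@orth_meet _ _ Z).
move=> x xZ xd; rewrite leNgt; apply/negP => xt; apply: h.
have x0 : 0 < nrm x.
  rewrite nrm_gt0; apply: contraTneq xt => ->.
  by rewrite bop0 nrm0 mulr0 ltxx.
exists ((nrm x)^-1%:C%C *: x); split.
- exact: (subspaceZ (orth_subspace _)).
- exact: (subspaceZ (orth_subspace _)).
- by rewrite nrmZ nrm_real gtr0_norm ?invr_gt0// mulVf// gt_eqF.
- rewrite bopZ nrmZ nrm_real gtr0_norm ?invr_gt0// mulrC ler_pdivrMr//.
  exact: ltW.
Qed.

(** Finitely many vectors never exhaust the approximate eigenvectors at a limit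
    point, so they can be picked recursively in the orthogonal complement of
    the previous ones, with geometrically decreasing defects. *)
Lemma ex_approximate_eigenvectors (t : R) : 0 < t -> exists e : nat -> H,
  [/\ orthonormal_or_zero e, forall n, nrm (e n) = 1, forall n, orth Z (e n) &
      forall n, nrm (T (e n)) <= t * 2^-1 ^+ n.+1].
Proof.
move=> t0.
have /choice[g gP] (s : seq H) : exists x, [/\ orth Z x,
    forall y, y \in s -> inner x y = 0, nrm x = 1 & nrm (T x) <= t * 2^-1 ^+ (size s).+1].
  have [|x [xZ xs x1 xT]] := @ex_approximate_eigenvector (nth 0 s) (size s)
      (t * 2^-1 ^+ (size s).+1).
    by rewrite mulr_gt0// exprn_gt0// invr_gt0.
  exists x; split=> // y ys; apply: xs; exists (index y s); rewrite ?nth_index//=.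
  by rewrite index_mem.
(* Each step only needs the list of the vectors already chosen. *)
pose L := fix L n := if n is m.+1 then rcons (L m) (g (L m)) else [::].
have sL n : size (L n) = n by elim: n => //= n IH; rewrite size_rcons IH.
have LS m n : (m < n)%N -> g (L m) \in L n.
  elim: n => // n IH; rewrite ltnS leq_eqVlt /= mem_rcons inE => /orP[/eqP ->|mn].
    by rewrite eqxx.
  by rewrite IH// orbT.
have lt m n : (m < n)%N -> inner (g (L n)) (g (L m)) = 0.
  by move=> mn; have [_ h _ _] := gP (L n); apply: h; exact: LS.
exists (fun n => g (L n)); split.
- split=> [m n mn|n]; last by right; case: (gP (L n)).
  have [mn'|nm|//] := ltngtP m n; last exact: lt.
  by apply: inner_eq0C; exact: lt.
- by move=> n; case: (gP (L n)).
- by move=> n; case: (gP (L n)).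
- by move=> n; have [_ _ _] := gP (L n); rewrite sL.
Qed.

Lemma orth_orth_span d : orth (orth (range d)) `<=` closure [set x | exists n, in_span d n x].
Proof.
have mono m n x : (m <= n)%N -> in_span d m x -> in_span d n x.
  by move=> /subnK <-; elim: (n - m)%N => // k IH /IH; exact: in_spanS.
have sG : closed_subspace (closure [set x | exists n, in_span d n x]).
  apply: closure_subspace => [|c x y [m mx] [n ny]].
    by exists 0%N, (fun=> 0); rewrite big_ord0.
  exists (maxn m n); apply: in_spanP.
    exact: mono (leq_maxl m n) mx.
  exact: mono (leq_maxr m n) ny.
move=> x xd; apply: (orth_orth sG) => y yG; apply: xd => _ [n _ <-]; apply: yG.
by apply: subset_closure; exists n.+1; exact: in_span_last.
Qed.

Section Perturbation.
Variables (t : R) (e : nat -> H).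
Hypotheses (t0 : 0 < t) (eo : orthonormal_or_zero e) (e1 : forall n, nrm (e n) = 1).
Hypotheses (eZ : forall n, orth Z (e n)).
Hypothesis eT : forall n, nrm (T (e n)) <= t * 2^-1 ^+ n.+1.

(** The defects are summable, hence [T] is small on the whole closed span. *)
Lemma small_on_span x : orth (orth (range e)) x -> nrm (T x) <= t * nrm x.
Proof.
move=> xe.
have spT v n : in_span e n v -> nrm (T v) <= t * nrm v.
  move=> [k vE]; have kv j : (j < n)%N -> nrm (k j) <= nrm v.
    move=> jn; have -> : k j = inner v (e j).
      rewrite vE inner_suml (bigD1 (Ordinal jn))//= innerZl innerxx e1 expr1n mulr1.
      rewrite big1 ?addr0// => i ij; rewrite innerZl eo.1 ?mulr0// => ijE.
      by move/eqP: ij; apply; exact: val_inj.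
    by rewrite (le_trans (cauchy_schwarz _ _))// e1 mulr1.
  rewrite {1}vE bop_sum (le_trans (nrm_sum _ _ _))//.
  apply: (@le_trans _ _ (\sum_(j < n) nrm v * (t * 2^-1 ^+ j.+1))).
    apply: ler_sum => j _; rewrite bopZ nrmZ.
    by apply: ler_pM; rewrite ?nrm_ge0// kv.
  rewrite -mulr_sumr mulrC ler_wpM2r ?nrm_ge0// -mulr_sumr ger_pMr//.
  have -> : \sum_(j < n) 2^-1 ^+ j.+1 = 1 - 2^-1 ^+ n :> R.
    elim: n {vE kv} => [|n IH]; first by rewrite big_ord0 expr0 subrr.
    by rewrite big_ord_recr /= IH exprS; field.
  by rewrite gerBl exprn_ge0// invr_ge0.
have /closure_nrm cl := orth_orth_span xe.
apply/ler_addgt0Pr => s s0; pose M := t + nrm T.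
have M0 : 0 <= M by rewrite addr_ge0 ?nrm_ge0// ltW.
have [v [n nv] xv] := cl _ (divS_gt0 s0 M0).
have hM := mul_lt_divS s0 M0 xv; rewrite mulrDl in hM.
have h0 := spT _ _ nv; have h1 := nrm_le v x; have h2 := nrm_le (T x) (T v).
have h3 : nrm (T x - T v) <= nrm T * nrm (x - v) by rewrite -bopB nrm_bop.
have h4 : t * nrm v <= t * (nrm x + nrm (x - v)) by rewrite ler_pM2l// [nrm (x - v)]nrmC.
rewrite mulrDr in h4; lra.
Qed.

(** The range of [adjoint D] lies in the sum of the kernel [Z] of [T] and of the
    closed span of [e]. *)
Lemma small_on_range (D : bop H) x :
  (forall y, orth Z y -> orth (range e) y -> D y = 0) ->
  nrm (T (adjoint D x)) <= t * nrm D * nrm x.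
Proof.
move=> D0; set v := adjoint D x; set F := orth (orth (range e)).
have sF : closed_subspace F := orth_subspace _.
pose k := v - proj Z v - proj F v.
have ZF y y' : Z y -> F y' -> inner y y' = 0.
  move=> Zy Fy'; apply: inner_eq0C; apply: Fy' => _ [n _ <-].
  by apply: inner_eq0C; exact: eZ.
have kZ : orth Z k.
  move=> y Zy; rewrite innerBl (proj_orth sZ)// sub0r.
  by rewrite (inner_eq0C (ZF _ _ Zy (proj_in sF v))) oppr0.
have ke : orth (range e) k.
  move=> _ [n _ <-]; have Fe : F (e n).
    by move=> y ye; apply: inner_eq0C; apply: ye; exists n.
  rewrite /k addrAC innerBl (proj_orth sF)// sub0r (ZF _ _ (proj_in sZ v) Fe).
  by rewrite oppr0.
have k0 : k = 0.
  apply: inner_self_eq0; rewrite {1}/k !innerBl adjE2 D0// inner0r.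
  rewrite (inner_eq0C (kZ _ (proj_in sZ v))) !sub0r.
  by rewrite (proj_in sF v k ke) ?oppr0 ?addr0.
have -> : T v = T (proj F v).
  have vE : v = proj Z v + proj F v.
    by apply/eqP; rewrite -subr_eq0 opprD addrA; apply/eqP.
  by rewrite {1}vE bopD (proj_in sZ v : T (proj Z v) = 0) add0r.
rewrite (le_trans (small_on_span (proj_in sF v)))// -mulrA ler_pM2l//.
by rewrite (le_trans (nrm_proj sF v))// (le_trans (nrm_bop _ _))// nrm_adj.
Qed.

(** Write [a] as [T + z]. The scalar part contributes exactly [z] times the
    difference of [u u*] and [s s*]. With [D] for [u - s], the difference of
    [u T u*] and [s T s*] is [u T D* + D T s*], where [T] acts next to
    [D] only, so that [small_on_range] applies to both terms. *)
Lemma conjugation_perturbation (u s : bop H) : nrm u <= 1 -> nrm s <= 1 ->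
  (forall x, orth Z x -> orth (range e) x -> u x = s x) ->
  nrm (u * a * adjoint u -
       (s * a * adjoint s + z *: (u * adjoint u - s * adjoint s))) <= 4 * t.
Proof.
move=> u1 s1 us; pose D := u - s.
have D2 : nrm D <= 2.
  by rewrite (le_trans (nrmB _ _))// (_ : 2 = 1 + 1)// lerD.
have TD x : nrm (T (adjoint D x)) <= 2 * t * nrm x.
  rewrite (le_trans (@small_on_range D x _))//.
    by move=> y yZ ye; rewrite bop_subE us// subrr.
  by rewrite ler_wpM2r ?nrm_ge0// [2 * t]mulrC ler_pM2l.
have TDn : nrm (T * adjoint D) <= 2 * t.
  by apply: nrm_bop_le => [|x]; [rewrite mulr_ge0// ltW|exact: TD].
have DTn : nrm (D * T) <= 2 * t.
  rewrite -nrm_adj adjM; apply: nrm_bop_le => [|x]; first by rewrite mulr_ge0// ltW.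
  by rewrite bop_mulE (normal_nrmP T).1.
have -> : u * a * adjoint u - (s * a * adjoint s + z *: (u * adjoint u - s * adjoint s))
    = u * (T * adjoint D) + (D * T) * adjoint s.
  have aE x : a x = T x + z *: x by rewrite /T spectral_shiftE subrK.
  apply: bopP => x; have DX : adjoint D x = adjoint u x - adjoint s x.
    by rewrite /D adjB.
  set X := adjoint u x in DX *; set Y := adjoint s x in DX *.
  change (u (a X) - (s (a Y) + z *: (u X - s Y)) =
    u (T (adjoint D x)) + (u (T Y) - s (T Y))).
  rewrite DX (bopB T) (bopB u) subrKA !aE (bopD u) (bopD s) !bopZ scalerBr.
  by rewrite -[s (T Y) + _ + _]addrA [_ + (z *: u X - _)]addrC subrK opprD addrACA subrr addr0.
rewrite (le_trans (nrmD _ _))// (_ : 4 * t = 2 * t + 2 * t); last by ring.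
rewrite lerD// (le_trans (nrm_mul _ _))//.
  by rewrite -[leRHS]mul1r ler_pM ?nrm_ge0.
by rewrite nrm_adj -[leRHS]mulr1 ler_pM ?nrm_ge0.
Qed.
End Perturbation.
End LimitPoint.
End ApproximateEigenvectors.

(** * Leaving the orbit at a nonzero limit point *)

Section Splice.
Context (R : realType) (H : hilbertType R).
Implicit Types (x y q w : H) (c : R[i]) (a b T s u : bop H) (S V : set H).
Hypothesis sepH : separable H.

Local Notation proj := (@orthogonal_projection R H).

Lemma isometry_nrm u : adjoint u * u = 1 -> nrm u <= 1.
Proof.
move=> uu; apply: nrm_bop_le => // x; rewrite mul1r -ler_sqr ?nnegrE ?nrm_ge0//.
by rewrite !nrm2E adjE -bop_mulE uu bop_oneE.
Qed.

(** The isometry follows [s] off the span of [e] and is rerouted to send [e] to [f];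
    the orthogonality of [f] to the image of the rest keeps it isometric. *)
Lemma splice_isometry (I : Type) (e f : I -> H) s : adjoint s * s = 1 ->
  orthonormal_or_zero e -> orthonormal_or_zero f -> (forall i, e i = 0 <-> f i = 0) ->
  (forall i x, orth (range e) x -> inner (f i) (s x) = 0) ->
  exists u, [/\ adjoint u * u = 1, forall i, u (e i) = f i,
    forall x, orth (range e) x -> u x = s x,
    forall i, adjoint u (f i) = e i &
    forall y, orth (range f) y ->
      adjoint u y = adjoint s y - proj (orth (orth (range e))) (adjoint s y)].
Proof.
move=> ss eo fo ef fs; set M := orth (orth (range e)).
have sM : closed_subspace M := orth_subspace _.
have [V [Ve Vf V0 V'0]] := ex_partial_isometry sepH eo fo ef.
have eM i : M (e i) by move=> y ye; apply: inner_eq0C; apply: ye; exists i.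
have oM x : orth (range e) x -> orth M x.
  by move=> xe y My; apply: inner_eq0C; exact: My.
pose u := s * (1 - proj M) + V.
have uE x : u x = s (x - proj M x) + V x by [].
have u'E x : adjoint u x = (adjoint s x - proj M (adjoint s x)) + adjoint V x.
  by rewrite /u adjD adjM adjB adj1 (adj_proj sM).
have ue i : u (e i) = f i by rewrite uE (proj_id sM)// subrr bop0 add0r Ve.
have ux x : orth (range e) x -> u x = s x.
  by move=> xe; rewrite uE V0// addr0 (proj_eq0 sM) ?subr0//; exact: oM.
have u'f i : adjoint u (f i) = e i.
  rewrite u'E Vf (proj_id sM) ?subrr ?add0r// => x xe.
  by rewrite adjE2 fs.
exists u; split=> //.
- apply: (bop_eq_orth (S := range e)) => [_ [i _ <-]|x xe]; rewrite bop_mulE bop_oneE.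
    by rewrite ue.
  rewrite ux// u'E -bop_mulE ss bop_oneE V'0 ?addr0.
    by rewrite (proj_eq0 sM) ?subr0//; exact: oM.
  by move=> _ [i _ <-]; apply: inner_eq0C; exact: fs.
- by move=> y yf; rewrite u'E V'0// addr0.
Qed.

Section LimitPoint.
Variables (a : bop H) (na : normal_op a) (z : R[i]).
Hypotheses (z0 : z != 0) (zlim : limit_point (spectrum a) z).
Hypothesis Ocl : closed (groupoid_orbit a).
Let Z := eigenspace a z.
Let sZ : closed_subspace Z := eigenspace_subspace a z.

Lemma orbit_isometry u : adjoint u * u = 1 -> groupoid_orbit a (u * a * adjoint u).
Proof.
move=> uu; pose p := range_projection a; exists (u * p).
  rewrite /= adjM range_projection_adj mulrA -[p * _ * _]mulrA uu mulr1.
  apply: bopP => x; rewrite bop_mulE; apply: range_projection_id.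
  exact: (proj_in (closure_range_subspace a)).
rewrite adjM range_projection_adj; apply: bopP => x; rewrite !bop_mulE.
by rewrite mul_range_projection// range_projection_mul.
Qed.

(** The limit does not depend on the approximate eigenvectors as soon as the final
    projections of the rerouted isometries all differ from [s s*] by the same
    operator [K]. *)
Lemma orbit_perturbation_limit s (K : bop H) : nrm s <= 1 ->
  (forall e : nat -> H, orthonormal_or_zero e -> (forall n, nrm (e n) = 1) ->
    (forall n, orth Z (e n)) -> exists u, [/\ adjoint u * u = 1,
      forall x, orth Z x -> orth (range e) x -> u x = s x &
      u * adjoint u - s * adjoint s = K]) ->
  groupoid_orbit a (s * a * adjoint s + z *: K).
Proof.
move=> s1 h; apply: Ocl; apply/closure_nrm => t t0.
(* The perturbation bound 4 * (t / 8) stays strictly below t. *)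
have t8 : 0 < t / 8 by rewrite divr_gt0.
have [e [eo e1 eZ eT]] := ex_approximate_eigenvectors na zlim t8.
have [u [uu us uK]] := h e eo e1 eZ.
exists (u * a * adjoint u); first exact: orbit_isometry.
have := conjugation_perturbation na t8 eo e1 eZ eT (isometry_nrm uu) s1 us.
by rewrite uK nrmC; lra.
Qed.

Lemma unit_same_support (I : Type) (e f : I -> H) : (forall i, nrm (e i) = 1) ->
  (forall i, nrm (f i) = 1) -> forall i, e i = 0 <-> f i = 0.
Proof.
move=> e1 f1 i; split=> h.
  by have := e1 i; rewrite h nrm0 => /eqP; rewrite eq_sym oner_eq0.
by have := f1 i; rewrite h nrm0 => /eqP; rewrite eq_sym oner_eq0.
Qed.

(** The shift along an orthonormal sequence. *)
Lemma ex_proper_isometry : exists s q,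
  [/\ adjoint s * s = 1, adjoint s q = 0 & nrm q = 1].
Proof.
have [e [eo e1 _ _]] := ex_approximate_eigenvectors na zlim (@ltr01 R).
have [||||u [uu _ _ _ u0]] := @splice_isometry nat e (e \o S) 1 _ eo.
- by rewrite adj1 mul1r.
- split=> [m n mn|n]; last exact: eo.2.
  by apply: eo.1 => -[].
- exact: unit_same_support e1 (fun i => e1 i.+1).
- by move=> i x xe; apply: inner_eq0C; apply: xe; exists i.+1.
exists u, (e 0%N); split=> //.
rewrite u0 => [|_ [n _ <-]]; last by rewrite eo.1.
rewrite adj1 bop_oneE (proj_id (orth_subspace _)) ?subrr// => x xe.
by apply: inner_eq0C; apply: xe; exists 0%N.
Qed.

Lemma ex_rank_one q : exists K : bop H, forall x, K x = inner x q *: q.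
Proof.
apply: (@ex_bop R H _ (nrm q ^+ 2)) => [c x y|x].
  by rewrite innerDl innerZl scalerDl scalerA.
rewrite nrmZ mulrC expr2 -mulrA ler_wpM2l ?nrm_ge0// mulrC.
exact: cauchy_schwarz.
Qed.

(** If [z] is not an eigenvalue, it can be made one. Conjugate by an isometry [s]
    with a unit vector [q] orthogonal to its range, and shift the approximate
    eigenvectors by one step so that the first is sent to [q]: the limit is
    [s a s*] plus [z] times the projection on [q], which has the eigenvalue [z].
    Elements of the orbit have the same nonzero eigenvalues as [a]. *)
Lemma closed_orbit_eigenspace_nontrivial : (forall x, Z x -> x = 0) -> False.
Proof.
move=> Z0; have [s [q [ss sq q1]]] := ex_proper_isometry.
have [K KE] := ex_rank_one q.
have sqx x : inner (s x) q = 0 by rewrite adjE sq inner0r.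
have qq : inner q q = 1 by rewrite innerxx q1 expr1n.
have [] := @orbit_perturbation_limit s K (isometry_nrm ss).
  move=> e eo e1 _; pose f n := if n is m.+1 then s (e m) else q.
  have s_nrm x : nrm (s x) = nrm x.
    by apply/eqP; rewrite -(eqrXn2 (n := 2)) ?nrm_ge0// !nrm2E adjE -bop_mulE ss bop_oneE.
  have f1 n : nrm (f n) = 1 by case: n => //= n; rewrite s_nrm.
  have fo : orthonormal_or_zero f.
    split=> [[|m] [|n] mn //=|n]; last by right.
    - by apply: inner_eq0C; exact: sqx.
    - by rewrite adjE -bop_mulE ss bop_oneE eo.1// => mnE; apply: mn; rewrite mnE.
  have [||u [uu ue us u'f u'0]] := splice_isometry ss eo fo.
  - exact: unit_same_support e1 f1.
  - move=> [|n] x xe /=; first by apply: inner_eq0C; exact: sqx.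
    by rewrite adjE -bop_mulE ss bop_oneE; apply: inner_eq0C; apply: xe; exists n.
  exists u; split=> //; first by move=> x _; exact: us.
  apply: (bop_eq_orth (S := range f)) => [_ [n _ <-]|x xf].
    rewrite bop_subE !bop_mulE u'f ue KE; case: n => [|n] /=.
      by rewrite sq bop0 subr0 qq scale1r.
    by rewrite -[adjoint s (s _)]bop_mulE ss bop_oneE subrr sqx scale0r.
  have s'e : orth (range e) (adjoint s x).
    by move=> _ [n _ <-]; rewrite adjE2; apply: xf; exists n.+1.
  rewrite bop_subE !bop_mulE u'0// (proj_eq0 (orth_subspace _)); last first.
    by move=> y ye; apply: inner_eq0C; exact: ye.
  by rewrite subr0 us// subrr KE (xf q) ?scale0r//; exists 0%N.
move=> v vp bE.
have bq : (v * a * adjoint v) q = z *: q.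
  by rewrite bE bop_addE bop_scaleE !bop_mulE sq !bop0 add0r KE qq scale1r.
have v'q : adjoint v q = 0.
  apply: Z0; apply/eigenspaceE.
  by rewrite -(orbit_intertwine vp) bq bopZ.
move: bq; rewrite bop_mulE v'q bop0 => /esym/eqP.
by rewrite scaler_eq0 (negbTE z0) -nrm_eq0 q1 oner_eq0.
Qed.

(** If [z] is an eigenvalue, it can be removed. Approximate eigenvectors outside
    the eigenspace [Z] make room for [Z] at small cost, and the limit is the
    restriction of [a] to the complement of [Z], extended by 0, which does not
    have the eigenvalue [z] any more. *)
Lemma closed_orbit_eigenspace_trivial x0 : Z x0 -> x0 <> 0 -> False.
Proof.
move=> Zx0 x00; pose s : bop H := 1 - proj Z.
have sE x : s x = x - proj Z x by [].
have s' : adjoint s = s by rewrite /s adjB adj1 (adj_proj sZ).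
have ss x : s (s x) = s x.
  by rewrite !sE bopB (proj_id sZ (proj_in sZ x)) subrr subr0.
have s1 : nrm s <= 1.
  by apply: nrm_bop_le => // x; rewrite mul1r sE nrm_projC.
have [g [go gZ gc]] := ex_basis sepH sZ.
have [] := @orbit_perturbation_limit s 0 s1.
  move=> y yo y1 yZ.
  (* For each basis vector g k of Z, a whole row of approximate eigenvectors
     is reserved; g k moves to the first place of its row and every entry of
     the row moves one step along. Rows of zero entries stay zero. *)
  pose f (i : nat * nat) : H := if g i.2 == 0 then 0 else y (pickle i).
  pose e (i : nat * nat) : H := if i.1 is j.+1 then f (j, i.2) else g i.2.
  have fZ i : orth Z (f i).
    by rewrite /f; case: eqP => _; [exact: subspace0 (orth_subspace _)|exact: yZ].
  have fo : orthonormal_or_zero f.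
    split=> [i j ij|i]; rewrite /f; last by case: eqP => _; [left|right].
    case: eqP => _; first exact: inner0l.
    case: eqP => _; first exact: inner0r.
    by apply: yo.1 => /(pcan_inj pickleK).
  have eo : orthonormal_or_zero e.
    split=> [[[|i] k] [[|j] l] ij|[[|i] k]]; rewrite /e /=.
    - by apply: go.1 => kl; apply: ij; rewrite kl.
    - by apply: inner_eq0C; apply: fZ; exact: gZ.
    - by apply: fZ; exact: gZ.
    - by apply: fo.1 => -[ijE klE]; apply: ij; rewrite ijE klE.
    - exact: go.2.
    - exact: fo.2.
  have f0 i : f i = 0 <-> g i.2 = 0.
    rewrite /f; case: eqP => // gi; split=> // yi.
    by have := y1 (pickle i); rewrite yi nrm0 => /eqP; rewrite eq_sym oner_eq0.
  have ef i : e i = 0 <-> f i = 0.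
    by case: i => [[|i] k]; rewrite /e /= f0//= f0.
  have [||u [uu ue us u'f u'0]] := splice_isometry (s := 1) _ eo fo ef.
  - by rewrite adj1 mul1r.
  - by move=> [i k] x xe; apply: inner_eq0C; apply: xe; exists (i.+1, k).
  exists u; split=> //.
    move=> x xZ xy; rewrite us ?bop_oneE ?sE ?(proj_eq0 sZ) ?subr0// => _ [[[|i] k] _ <-].
      by rewrite /e /= xZ.
    by rewrite /e /= /f; case: eqP => _; [exact: inner0r|apply: xy; exists (pickle (i, k))].
  rewrite s'; apply: (bop_eq_orth (S := range f)) => [_ [i _ <-]|x xf].
    by rewrite bop_subE !bop_mulE u'f ue ss sE (proj_eq0 sZ (fZ i)) subr0 subrr.
  set M := orth (orth (range e)) in u'0.
  have sM : closed_subspace M := orth_subspace _.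
  have xe : orth (range e) (x - proj Z x).
    move=> _ [[[|i] k] _ <-]; rewrite /e /=; first exact: (proj_orth sZ).
    by rewrite innerBl (inner_eq0C (fZ _ _ (proj_in sZ x))) xf ?subr0//; exists (i, k).
  have MZ w : Z w -> M w.
    move=> Zw v ve; apply: inner_eq0C.
    apply: (basis_orth sZ gZ gc _ Zw) => _ [k _ <-].
    by apply: ve; exists (0%N, k).
  have Mx : proj M x = proj Z x.
    apply: (proj_eq sM); first by apply: MZ; exact: (proj_in sZ).
    by move=> w Mw; apply: inner_eq0C; exact: Mw.
  by rewrite bop_subE !bop_mulE u'0// adj1 bop_oneE Mx us// bop_oneE ss sE subrr.
move=> v vp; rewrite s' scaler0 addr0 => bE.
have x0n : nrm (v x0) = nrm x0 by rewrite (orbit_nrm vp) (range_projection_eigen z0 Zx0).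
set y := v x0 in x0n.
have by' : s (a (s y)) = z *: y.
  rewrite -[LHS]/((s * a * s) y) -bE (orbit_mul na vp).
  by rewrite ((eigenspaceE _ _ _).1 Zx0) bopZ.
have sy : s y = y.
  have yE : y = s (z^-1 *: a (s y)) by rewrite bopZ by' scalerK.
  by rewrite [in LHS]yE ss -yE.
have yZ : orth Z y by rewrite -sy; exact: (proj_orth sZ).
have ayZ : orth Z (a y).
  move=> w Zw; rewrite adjE (normal_adj_eigen na Zw) innerZr yZ ?mulr0//.
have Zy : Z y.
  apply/eigenspaceE; rewrite -by' sy sE (proj_eq0 sZ ayZ) subr0//.
apply: x00; apply/eqP; rewrite -nrm_eq0 -x0n nrm_eq0; apply/eqP.
exact: orth_meet Zy yZ.
Qed.
End LimitPoint.
End Splice.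

Theorem corollary5p5 (R : realType) (H : hilbertType R)
    (sepH : separable H) (infH : ~ finite_dimensional H)
    (a : bop H) (na : normal_op a) :
  closed (groupoid_orbit a) <->
  (forall z : R[i], limit_point (spectrum a) z -> z = 0).
Proof.
split=> [Ocl z zlim|spec0].
  apply/eqP/negPn/negP => z0.
  have [Z0|/existsNP[x /not_implyP[Zx x0]]] :=
      pselect (forall x, eigenspace a z x -> x = 0).
    exact (closed_orbit_eigenspace_nontrivial sepH na z0 zlim Ocl Z0).
  exact (closed_orbit_eigenspace_trivial sepH na z0 zlim Ocl Zx x0).
move=> b /closure_nrm cb; apply: orbit_limit_in_orbit => //.
  move=> t t0; have [_ [v vp <-] bv] := cb t t0.
  by exists v.
move=> c c0; have : ~ limit_point (spectrum a) c.
  by move=> /spec0 cE; rewrite cE eqxx in c0.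
move=> nl; apply: contrapT => ni; apply: nl; apply/limit_point_nrm => t t0.
apply: contrapT => h; apply: ni; exists t => // w w0 wt.
apply: contrapT => nb; apply: h; exists (c + w); split.
- by rewrite -subr_eq0 addrC addKr -nrm_gt0.
- exact/spectrumP.
- by rewrite opprD addrA subrr sub0r nrmN.
Qed.
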